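(* Let $m,k\ge 1$, $f\in\mathbb{Q}^m\setminus\mathbb{Z}^m$ and $r^1,\dots,r^k\in\mathbb{Q}^m\setminus\{0\}$, and assume the set $X=\{(x,s)\in\mathbb{Z}^m\times\mathbb{R}^k_+ : x=f+\sum_{j=1}^k r^j s_j\}$ is nonempty. Let $P=\{(x,s)\in\mathbb{R}^m\times\mathbb{R}^k_+ : x=f+\sum_{j=1}^k r^j s_j\}$ be its linear relaxation. Let $L$ be a rational lattice-free polytope in $\mathbb{R}^m$ containing $f$ in its interior and having rays going into its corners. Then the $L$-cut $\sum_{j=1}^k \psi(r^j)s_j\ge 1$ has finite split rank with respect to $P$ if and only if $L$ has the 2-hyperplane property.
   Context: A convex set is lattice-free if its interior contains no point of $\mathbb{Z}^m$. $\psi$ is the gauge of $L-f$: $\psi(r)=\inf\{t>0 : r/t\in L-f\}$; the inequality $\sum_j\psi(r^j)s_j\ge 1$ is called the $L$-cut. For $j=1,\dots,k$, the boundary point of ray $r^j$ is the intersection of the half-line $\{f+\lambda r^j:\lambda\ge 0\}$ with the boundary of $L$; $L$ has rays going into its corners if every vertex of $L$ is the boundary point of at least one $r^j$. A split is a pair $(\pi,\pi_0)$ with $\pi\in\mathbb{Z}^m$, $\pi_0\in\mathbb{Z}$, acting on the $x$ variables; its boundary hyperplanes are $\{\pi x=\pi_0\}$ and $\{\pi x=\pi_0+1\}$. For a polyhedron $Q$ in $(x,s)$-space, $Q(\pi,\pi_0)=\mathrm{conv}\big((Q\cap\{\pi x\le\pi_0\})\cup(Q\cap\{\pi x\ge \pi_0+1\})\big)$.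 The split closure of $Q$ is the intersection of $Q(\pi,\pi_0)$ over all splits; the rank-0 split closure is $Q$, and the rank-$t$ split closure is the split closure of the rank-$(t-1)$ split closure. The split rank of an inequality valid for $\mathrm{conv}(X)$ with respect to $Q$ is the smallest $t\ge0$ such that it is valid for the rank-$t$ split closure of $Q$, or $+\infty$ if no such $t$ exists. A set $S\subseteq\mathbb{R}^m$ is 2-partitionable if $|S|\le 1$ or there is a partition of $S$ into nonempty sets $S_1,S_2$ and a split such that $S_1$ lies on one boundary hyperplane of the split and $S_2$ on the other. A polytope is 2-partitionable if its set of integer points is. For a rational lattice-free polytope $L$, let $L_I$ be the convex hull of the integer points in $L$; $L$ has the 2-hyperplane property if every face of $L_I$ that is not contained in a facet of $L$ is 2-partitionable. *)

(* Defs.v *)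
From HB Require Import structures.
From mathcomp Require Import all_boot all_order all_algebra.
From mathcomp Require Import classical_sets reals.
Set Implicit Arguments. Unset Strict Implicit. Unset Printing Implicit Defensive.
Import Order.TTheory GRing.Theory Num.Theory.
Local Open Scope ring_scope.
Local Open Scope classical_set_scope.

Section Defs.
Variable R : realType.

Definition conv (V : lmodType R) (S : set V) : set V :=
  [set x | exists (n : nat) (w : 'I_n -> R) (p : 'I_n -> V),
     (forall i, 0 <= w i) /\ \sum_(i < n) w i = 1 /\ (forall i, S (p i)) /\
     x = \sum_(i < n) w i *: p i].

Definition is_int (x : R) : Prop := exists z : int, x = z%:~R.
Definition is_rat (x : R) : Prop := exists q : rat, x = ratr q.

Variable m : nat.
Definition int_pt (x : 'rV[R]_m) : Prop := forall i, is_int (x 0 i).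
Definition rat_pt (x : 'rV[R]_m) : Prop := forall i, is_rat (x 0 i).

Definition dotR (a x : 'rV[R]_m) : R := \sum_(i < m) a 0 i * x 0 i.

(* interior (for the sup-norm, equivalently any norm on R^m) *)
Definition interior_pt (S : set 'rV[R]_m) (x : 'rV[R]_m) : Prop :=
  exists eps : R, 0 < eps /\
    forall y : 'rV[R]_m, (forall i, `|y 0 i - x 0 i| < eps) -> S y.

(* boundary point of a closed set *)
Definition boundary_pt (S : set 'rV[R]_m) (x : 'rV[R]_m) : Prop :=
  S x /\ ~ interior_pt S x.

Definition lattice_free (S : set 'rV[R]_m) : Prop :=
  forall x, int_pt x -> ~ interior_pt S x.

Definition rational_polytope (S : set 'rV[R]_m) : Prop :=
  exists V : seq 'rV[R]_m, (forall v, v \in V -> rat_pt v) /\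
    S = conv (fun x => x \in V).

Definition valid_ineq (S : set 'rV[R]_m) (a : 'rV[R]_m) (b : R) : Prop :=
  forall x, S x -> dotR a x <= b.

Definition face (S F : set 'rV[R]_m) : Prop :=
  exists (a : 'rV[R]_m) (b : R), valid_ineq S a b /\
    F = [set x | S x /\ dotR a x = b].

Definition vertex (S : set 'rV[R]_m) (v : 'rV[R]_m) : Prop := face S [set v].

Definition has_aff_indep (S : set 'rV[R]_m) (n : nat) : Prop :=
  exists p : 'I_n -> 'rV[R]_m, (forall i, S (p i)) /\
    row_free (\matrix_(i < n) row_mx (p i) (const_mx 1 : 'rV[R]_1)).

Definition dim_eq (S : set 'rV[R]_m) (d : nat) : Prop :=
  has_aff_indep S d.+1 /\ ~ has_aff_indep S d.+2.

Definition facet (S F : set 'rV[R]_m) : Prop :=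
  face S F /\ exists d : nat, dim_eq S d.+1 /\ dim_eq F d.

Definition int_hull (S : set 'rV[R]_m) : set 'rV[R]_m :=
  conv [set x | S x /\ int_pt x].

Definition intvecR (pi : 'rV[int]_m) : 'rV[R]_m := map_mx (fun z : int => z%:~R) pi.

Definition two_partitionable (S : set 'rV[R]_m) : Prop :=
  (forall x y, S x -> S y -> x = y) \/
  exists (S1 S2 : set 'rV[R]_m) (pi : 'rV[int]_m) (pi0 : int),
    S1 `<=` S /\ S2 `<=` S /\ S `<=` S1 `|` S2 /\ S1 `&` S2 = set0 /\
    S1 !=set0 /\ S2 !=set0 /\
    (forall x, S1 x -> dotR (intvecR pi) x = pi0%:~R) /\
    (forall x, S2 x -> dotR (intvecR pi) x = pi0%:~R + 1).

Definition two_hyperplane_property (L : set 'rV[R]_m) : Prop :=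
  forall F, face (int_hull L) F ->
    ~ (exists G, facet L G /\ F `<=` G) ->
    two_partitionable (F `&` int_pt).

Variable k : nat.

Definition gauge (L : set 'rV[R]_m) (f r : 'rV[R]_m) : R :=
  inf [set t : R | 0 < t /\ L (f + t^-1 *: r)].

Definition rays_into_corners (L : set 'rV[R]_m) (f : 'rV[R]_m)
    (r : 'I_k -> 'rV[R]_m) : Prop :=
  forall v, vertex L v ->
    exists j : 'I_k, exists lam : R, 0 <= lam /\ v = f + lam *: r j /\
      boundary_pt L v.

Definition XS := ('rV[R]_m * 'rV[R]_k)%type.

Definition relaxP (f : 'rV[R]_m) (r : 'I_k -> 'rV[R]_m) : set XS :=
  [set z : XS | (forall j, 0 <= z.2 0 j) /\ z.1 = f + \sum_(j < k) z.2 0 j *: r j].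

Definition mixed_set (f : 'rV[R]_m) (r : 'I_k -> 'rV[R]_m) : set XS :=
  [set z : XS | relaxP f r z /\ int_pt z.1].

Definition split_hull (Q : set XS) (pi : 'rV[int]_m) (pi0 : int) : set XS :=
  @conv [the lmodType R of XS]
    ((Q `&` [set z : XS | dotR (intvecR pi) z.1 <= pi0%:~R]) `|`
     (Q `&` [set z : XS | pi0%:~R + 1 <= dotR (intvecR pi) z.1])).

Definition split_closure (Q : set XS) : set XS :=
  [set z | forall (pi : 'rV[int]_m) (pi0 : int), split_hull Q pi pi0 z].

Definition rank_split_closure (t : nat) (Q : set XS) : set XS :=
  iter t split_closure Q.

Definition Lcut_valid (L : set 'rV[R]_m) (f : 'rV[R]_m) (r : 'I_k -> 'rV[R]_m)
    (Q : set XS) : Prop :=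
  forall z, Q z -> 1 <= \sum_(j < k) gauge L f (r j) * z.2 0 j.

Definition Lcut_finite_split_rank (L : set 'rV[R]_m) (f : 'rV[R]_m)
    (r : 'I_k -> 'rV[R]_m) : Prop :=
  exists t : nat, Lcut_valid L f r (rank_split_closure t (relaxP f r)).

End Defs.

(* Main.v *)
Require Import Defs.
From HB Require Import structures.
From mathcomp Require Import all_boot all_order all_algebra.
From mathcomp Require Import zify ring lra.
From mathcomp Require Import boolp classical_sets reals.
Set Implicit Arguments. Unset Strict Implicit. Unset Printing Implicit Defensive.
Import Order.TTheory GRing.Theory Num.Theory.
Local Open Scope ring_scope.
Local Open Scope classical_set_scope.

(* Write [h = 1 - sum_j psi(r^j) s_j], so that the cut reads [h <= 0] and every supporting
   inequality of [L], normalised to an affine function [phi] with [phi f = 1], gives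
   [h <= phi x] on the relaxation.

   Necessity. Let [F] be a face of the integer hull lying in no facet of [L], with integer
   points [v_1, ..., v_n] that are not 2-partitionable. Their barycentre is interior to
   [L], so it lifts to a point violating the cut, while the [v_i] lift to points of all
   closures. If a split strip contains the barycentre, some [v_i] is at least one unit
   beyond the strip, and the midpoint of [v_i] and the violating point lies outside the
   open strip; averaging it with the other [v_j] gives a violating point of the next
   closure on the same segment, at a position that does not depend on the split.

   Sufficiency. For every affine [l] such that [h + l <= 0] at the integer points, the
   supremum of [h + l] over the closures tends to at most 0: adding a small convex
   potential with kinks at the half-integers, each round of elementary splits lowers the
   maximum by a constant away from the integer points. Finite rank is then proved for the
   tilted cuts [h + l <= 0] by induction on the number of integer points where they are
   tight. If these points lie on [phi = 0] for a supporting [phi], then [phi + l] is a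
   rational affine function vanishing there, and one split parallel to it finishes, since
   [h + l <= phi + l] on one side and a slightly tilted cut is almost valid on the other.
   Otherwise they are 2-partitionable, and tilting along the split to either side gives
   cuts with fewer tight points, which are valid on the two sides of that split. *)

(** * Convex hulls and convex sets *)

Section Convexity.
Variable R : realType.
Implicit Types V : lmodType R.

(** Any finite index type is allowed, so combinations over [bool] or over dependent pairs need no
    renumbering. *)
Lemma conv_fin V (S : set V) (I : finType) (w : I -> R) (p : I -> V) :
  (forall i, 0 <= w i) -> \sum_i w i = 1 -> (forall i, S (p i)) ->
  conv S (\sum_i w i *: p i).
Proof.
move=> w0 w1 Sp.
exists #|I|, (w \o enum_val), (p \o enum_val); split=> [i|]; first exact: w0.
split; first by rewrite -w1 [RHS](reindex _ (onW_bij _ (enum_val_bij I))).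
split=> [i|]; first exact: Sp.
by rewrite [LHS](reindex _ (onW_bij _ (enum_val_bij I))).
Qed.

Lemma sub_conv V (S : set V) : S `<=` conv S.
Proof.
move=> x Sx; exists 1%N, (fun=> 1), (fun=> x); split=> //.
by rewrite !big_ord1 scale1r.
Qed.

Lemma conv_mono V (S T : set V) : S `<=` T -> conv S `<=` conv T.
Proof.
move=> ST x [n [w [p [w0 [w1 [Sp ->]]]]]].
by exists n, w, p; split=> //; split=> //; split=> // i; apply: ST.
Qed.

Definition convex V (S : set V) := conv S `<=` S.

Lemma convex_sum V (S : set V) (I : finType) (w : I -> R) (p : I -> V) :
  convex S ->
  (forall i, 0 <= w i) -> \sum_i w i = 1 -> (forall i, S (p i)) ->
  S (\sum_i w i *: p i).
Proof. by move=> cS w0 w1 Sp; apply/cS/conv_fin. Qed.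

Lemma convex_two V (S : set V) (x y : V) (t : R) :
  convex S -> 0 <= t <= 1 -> S x -> S y -> S ((1 - t) *: x + t *: y).
Proof.
move=> cS /andP[t0 t1] Sx Sy.
have := @convex_sum _ S bool (fun b => if b then 1 - t else t)
  (fun b => if b then x else y) cS.
rewrite !big_bool /=; apply; last by case.
- by case; rewrite ?subr_ge0.
- by rewrite subrK.
Qed.

Lemma convex_conv V (S : set V) : convex (conv S).
Proof.
move=> _ [n [w [p [w0 [w1 [Sp ->]]]]]].
have [N [W [Q HQ]]] : exists (N : 'I_n -> nat) (W : forall i, 'I_(N i) -> R)
    (Q : forall i, 'I_(N i) -> V), forall i,
    [/\ forall j, 0 <= W i j, \sum_j W i j = 1, forall j, S (Q i j) &
      p i = \sum_j W i j *: Q i j].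
  have : forall i, exists t : {k : nat & (('I_k -> R) * ('I_k -> V))%type},
      [/\ forall j, 0 <= (tagged t).1 j, \sum_j (tagged t).1 j = 1,
        forall j, S ((tagged t).2 j) &
        p i = \sum_j (tagged t).1 j *: (tagged t).2 j].
    move=> i; have [k [u [q [u0 [u1 [Sq ->]]]]]] := Sp i.
    by exists (Tagged (fun k => (('I_k -> R) * ('I_k -> V))%type) (u, q)).
  move=> /choice[t Ht].
  by exists (fun i => tag (t i)), (fun i => (tagged (t i)).1), (fun i => (tagged (t i)).2).
(* A combination of combinations is one combination over all pairs [(i, j)], with weights
   [w i * W i j]. *)
pose I := {i : 'I_n & 'I_(N i)}.
have -> : \sum_(i < n) w i *: p i =
    \sum_(k : I) (w (tag k) * W (tag k) (tagged k)) *: Q (tag k) (tagged k).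
  transitivity (\sum_(i < n) \sum_(j < N i) (w i * W i j) *: Q i j); last first.
    exact: (sig_big_dep xpredT (fun=> xpredT) (fun i j => (w i * W i j) *: Q i j)).
  apply: eq_bigr => i _; have [_ _ _ Ep] := HQ i.
  rewrite [in LHS]Ep scaler_sumr; apply: eq_bigr => j _; exact: scalerA.
apply: conv_fin.
- by move=> k; apply: mulr_ge0; [exact: w0|have [] := HQ (tag k)].
- transitivity (\sum_(i < n) \sum_(j < N i) w i * W i j).
    by rewrite (sig_big_dep xpredT (fun=> xpredT) (fun i j => w i * W i j)).
  rewrite -[X in _ = X]w1; apply: eq_bigr => i _; have [_ W1 _ _] := HQ i.
  by rewrite -mulr_sumr W1 mulr1.
- by move=> k; have [] := HQ (tag k).
Qed.

End Convexity.

(** * Dot products and affine functions *)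

Section Affine.
Variables (R : realType) (m : nat).
Implicit Types (a x y : 'rV[R]_m).

Lemma dotRDr a x y : dotR a (x + y) = dotR a x + dotR a y.
Proof. by rewrite -big_split; apply: eq_bigr => i _; rewrite mxE mulrDr. Qed.

Lemma dotRZr a c x : dotR a (c *: x) = c * dotR a x.
Proof. by rewrite mulr_sumr; apply: eq_bigr => i _; rewrite mxE mulrCA. Qed.

Lemma dotRDl a b x : dotR (a + b) x = dotR a x + dotR b x.
Proof. by rewrite -big_split; apply: eq_bigr => i _; rewrite mxE mulrDl. Qed.

Lemma dotRZl a c x : dotR (c *: a) x = c * dotR a x.
Proof. by rewrite mulr_sumr; apply: eq_bigr => i _; rewrite mxE mulrA. Qed.

Lemma dotR0r a : dotR a 0 = 0.
Proof. by rewrite -[0 in LHS](scale0r 0) dotRZr mul0r. Qed.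

Lemma dotR0l x : dotR 0 x = 0.
Proof. by rewrite -[0 in LHS](scale0r 0) dotRZl mul0r. Qed.

Lemma dotRNl a x : dotR (- a) x = - dotR a x.
Proof. by rewrite -scaleN1r dotRZl mulN1r. Qed.

Lemma dotRNr a x : dotR a (- x) = - dotR a x.
Proof. by rewrite -scaleN1r dotRZr mulN1r. Qed.

Lemma dotRBr a x y : dotR a (x - y) = dotR a x - dotR a y.
Proof. by rewrite dotRDr dotRNr. Qed.

Lemma dotR_sumr a (I : finType) (w : I -> R) (p : I -> 'rV[R]_m) :
  dotR a (\sum_i w i *: p i) = \sum_i w i * dotR a (p i).
Proof.
rewrite (big_morph _ (dotRDr a) (dotR0r a)).
by apply: eq_bigr => i _; rewrite dotRZr.
Qed.

Lemma dotR_delta i x : dotR (delta_mx 0 i) x = x 0 i.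
Proof.
rewrite /dotR (bigD1 i) //= mxE !eqxx mul1r big1 ?addr0 // => j ji.
by rewrite mxE (negPf ji) andbF mul0r.
Qed.

(** The pair holds gradient and constant term; [R^o] makes such pairs a module, so affine functions
    can be added and scaled. *)
Definition aff (l : 'rV[R]_m * R^o) x := dotR l.1 x + l.2.

Lemma affD l l' x : aff (l + l') x = aff l x + aff l' x.
Proof. by rewrite /aff dotRDl; ring. Qed.

Lemma affZ c l x : aff (c *: l) x = c * aff l x.
Proof. by rewrite /aff dotRZl /=; rewrite mulrDr. Qed.

Lemma aff_sum l (I : finType) (w : I -> R) (p : I -> 'rV[R]_m) :
  \sum_i w i = 1 -> aff l (\sum_i w i *: p i) = \sum_i w i * aff l (p i).
Proof.
move=> w1; rewrite /aff dotR_sumr.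
rewrite -[X in _ + X]mul1r -w1 mulr_suml -big_split.
by apply: eq_bigr => i _; rewrite mulrDr.
Qed.

Lemma aff_conv_ge0 l (S : set 'rV[R]_m) :
  (forall x, S x -> 0 <= aff l x) -> forall x, conv S x -> 0 <= aff l x.
Proof.
move=> Sl _ [n [w [p [w0 [w1 [Sp ->]]]]]].
by rewrite aff_sum //; apply: sumr_ge0 => i _; apply: mulr_ge0 => //; apply: Sl.
Qed.

(** Nonnegative terms with zero sum vanish one by one: a supporting function vanishing at a convex
    combination vanishes at every point of nonzero weight. *)
Lemma aff_eq0_summand l (I : finType) (w : I -> R) (p : I -> 'rV[R]_m) :
  (forall i, 0 <= w i) -> \sum_i w i = 1 -> (forall i, 0 <= aff l (p i)) ->
  aff l (\sum_i w i *: p i) = 0 -> forall i, w i = 0 \/ aff l (p i) = 0.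
Proof.
move=> w0 w1 p0; rewrite aff_sum // => /eqP.
rewrite psumr_eq0 => [/allP H i|i _]; last exact: mulr_ge0.
have := H i (mem_index_enum _); rewrite /= mulf_eq0 => /orP[]/eqP; tauto.
Qed.

Lemma convex_face (S F : set 'rV[R]_m) : convex S -> face S F -> convex F.
Proof.
move=> cS [a [b [_ ->]]] _ [n [w [p [w0 [w1 [Sp ->]]]]]]; split.
  by apply: convex_sum => // i; have [] := Sp i.
rewrite dotR_sumr (eq_bigr (fun i => w i * b)); first by rewrite -mulr_suml w1 mul1r.
by move=> i _; have [_ ->] := Sp i.
Qed.

Definition rat_aff (l : 'rV[R]_m * R^o) := rat_pt l.1 /\ is_rat l.2.

End Affine.

(** * Rational numbers, points and affine functions *)

Section Rationality.
Variable R : realType.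

Lemma is_ratD (x y : R) : is_rat x -> is_rat y -> is_rat (x + y).
Proof. by move=> [p ->] [q ->]; exists (p + q); rewrite rmorphD. Qed.
Lemma is_ratM (x y : R) : is_rat x -> is_rat y -> is_rat (x * y).
Proof. by move=> [p ->] [q ->]; exists (p * q); rewrite rmorphM. Qed.
Lemma is_ratN (x : R) : is_rat x -> is_rat (- x).
Proof. by move=> [p ->]; exists (- p); rewrite rmorphN. Qed.
Lemma is_ratV (x : R) : is_rat x -> is_rat x^-1.
Proof. by move=> [p ->]; exists p^-1; rewrite fmorphV. Qed.
Lemma is_rat_nat n : is_rat (n%:R : R).
Proof. by exists n%:R; rewrite rmorph_nat. Qed.
Lemma is_rat_int (n : int) : is_rat (n%:~R : R).
Proof. by exists n%:~R; rewrite rmorph_int. Qed.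

Lemma is_rat_sum (I : finType) (F : I -> R) :
  (forall i, is_rat (F i)) -> is_rat (\sum_i F i).
Proof.
move=> HF; elim/big_ind: _ => //; [exact: (is_rat_nat 0)|exact: is_ratD].
Qed.

Variable m : nat.
Implicit Types (l : 'rV[R]_m * R^o).

Lemma rat_dotR (a x : 'rV[R]_m) : rat_pt a -> rat_pt x -> is_rat (dotR a x).
Proof. by move=> ra rx; apply: is_rat_sum => i; apply: is_ratM. Qed.

Lemma rat_aff_val l x : rat_aff l -> rat_pt x -> is_rat (aff l x).
Proof. by move=> [l1 l2] rx; apply: is_ratD => //; apply: rat_dotR. Qed.

Lemma rat_affD l l' : rat_aff l -> rat_aff l' -> rat_aff (l + l').
Proof.
by move=> [? ?] [? ?]; split; [move=> i; rewrite mxE|]; apply: is_ratD.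
Qed.

Lemma rat_affZ c l : is_rat c -> rat_aff l -> rat_aff (c *: l).
Proof.
by move=> ? [? ?]; split; [move=> i; rewrite mxE|]; apply: is_ratM.
Qed.

End Rationality.

(** * Half-space description of a rational polytope *)

Section HRepresentation.
Variables (R : realType) (m : nat).
Let E := ('rV[R]_m * R^o)%type.
Implicit Types (l x y v : E) (V : seq E).

(** The homogeneous form of [aff]: pairing with [(x, 1)] gives [aff l x]. *)
Definition pairing l x := dotR l.1 x.1 + l.2 * x.2.

Lemma pairingDr l x y : pairing l (x + y) = pairing l x + pairing l y.
Proof. by rewrite /pairing dotRDr /=; ring. Qed.
Lemma pairingZr l c x : pairing l (c *: x) = c * pairing l x.
Proof. by rewrite /pairing dotRZr /= /GRing.scale /=; ring. Qed.
Lemma pairingDl l l' x : pairing (l + l') x = pairing l x + pairing l' x.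
Proof. by rewrite /pairing dotRDl /=; ring. Qed.
Lemma pairingZl l c x : pairing (c *: l) x = c * pairing l x.
Proof. by rewrite /pairing dotRZl /= /GRing.scale /=; ring. Qed.

(** Nonnegative combinations of [V], written recursively so that each induction step eliminates one
    coefficient. *)
Fixpoint cone V x : Prop :=
  if V is v :: V' then exists t : R, 0 <= t /\ cone V' (x - t *: v) else x = 0.

Lemma cone_bounds (A B : seq E) (c : E -> R) :
  (forall b, b \in B -> 0 <= c b) ->
  (forall a b, a \in A -> b \in B -> c a <= c b) ->
  exists t, [/\ 0 <= t, forall a, a \in A -> c a <= t & forall b, b \in B -> t <= c b].
Proof.
move=> B0 AB; exists (\big[Num.max/0]_(a <- A) c a); split.
- exact: bigmax_ge_id.
- by move=> a aA; apply: le_bigmax_seq.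
- by move=> b bB; rewrite big_seq; apply: bigmax_le => [|a aA]; [exact: B0|exact: AB].
Qed.

(* One step of Fourier-Motzkin elimination: [cone (v :: V)] is the projection of
   the set of pairs (x, t) with [0 <= t] and [x - t *: v] in [cone V]. *)
Lemma cone_hrep V : (forall v, v \in V -> rat_aff v) ->
  exists H : seq E, (forall l, l \in H -> rat_aff l) /\
    forall x, cone V x <-> forall l, l \in H -> 0 <= pairing l x.
Proof.
elim: V => [_|v V IH rV].
  (* The cone of the empty list is the origin, cut out by both signs of every coordinate. *)
  pose H0 : seq E := [seq (delta_mx 0 i, 0) | i <- enum 'I_m] ++
    [seq (- delta_mx 0 i, 0) | i <- enum 'I_m] ++ [:: (0, 1); (0, -1)].
  have rd i : rat_pt (delta_mx 0 i : 'rV[R]_m).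
    by move=> j; rewrite mxE; apply: is_rat_nat.
  have r0 : rat_pt (0 : 'rV[R]_m) by move=> j; rewrite mxE; apply: (is_rat_nat _ 0).
  exists H0; split.
    move=> l; rewrite !mem_cat !inE => /or3P[/mapP[i _ ->]|/mapP[i _ ->]|/orP[]/eqP->];
      split=> //=; try exact: (is_rat_nat _ 0); try exact: (is_rat_nat _ 1).
      by move=> j; rewrite mxE; apply/is_ratN/rd.
    by apply/is_ratN/(is_rat_nat _ 1).
  move=> x; split=> [/= -> l _|Hx].
    by rewrite /pairing /= dotR0r mulr0 addr0.
  case: x Hx => x c Hx /=; congr (_, _).
    apply/rowP => i; rewrite mxE; apply/eqP; rewrite eq_le; apply/andP; split.
      have := Hx (- delta_mx 0 i, 0).
      rewrite /pairing /= dotRNl dotR_delta mul0r addr0 oppr_ge0; apply.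
      rewrite !mem_cat; apply/orP; right; apply/orP; left.
      by apply/mapP; exists i; rewrite ?mem_enum.
    have := Hx (delta_mx 0 i, 0).
    rewrite /pairing /= dotR_delta mul0r addr0; apply.
    by rewrite !mem_cat; apply/orP; left; apply/mapP; exists i; rewrite ?mem_enum.
  apply/eqP; rewrite eq_le; apply/andP; split.
    have := Hx (0, -1); rewrite /pairing /= dotR0l add0r mulN1r oppr_ge0; apply.
    by rewrite !mem_cat !inE eqxx !orbT.
  have := Hx (0, 1); rewrite /pairing /= dotR0l add0r mul1r; apply.
  by rewrite !mem_cat !inE eqxx !orbT.
have [H [rH HV]] := IH (fun w wV => rV w (@mem_behead _ (v :: V) w wV)).
have rv := rV v (mem_head _ _).
have rp l : l \in H -> is_rat (pairing l v).
  move=> /rH [? ?]; case: rv => ? ?.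
  by apply: is_ratD; [apply: rat_dotR|apply: is_ratM].
(* [comb l l'] vanishes at [v]; for [l] in [P] and [l'] in [N] both multipliers are positive. *)
pose comb l l' := pairing l v *: l' + (- pairing l' v) *: l.
pose P := [seq l <- H | 0 < pairing l v].
pose N := [seq l <- H | pairing l v < 0].
exists ([seq l <- H | 0 <= pairing l v] ++ [seq comb l l' | l <- P, l' <- N]).
split.
  move=> l; rewrite mem_cat mem_filter => /orP[/andP[_ /rH]//|].
  move=> /allpairsP[[l1 l2]] /= [].
  rewrite !mem_filter => /andP[_ H1] /andP[_ H2] ->.
  by apply: rat_affD; (apply: rat_affZ; last exact: rH); [|apply: is_ratN]; apply: rp.
move=> x; split.
  move=> /= [t [t0 /HV Hx]] l.
  have {}Hx l' : l' \in H -> t * pairing l' v <= pairing l' x.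
    by move=> /Hx; rewrite -scaleNr pairingDr pairingZr mulNr subr_ge0.
  rewrite mem_cat mem_filter => /orP[/andP[l0 /Hx]|].
    by apply: le_trans; apply: mulr_ge0.
  move=> /allpairsP[[l1 l2]] /= [].
  rewrite !mem_filter => /andP[p1 /Hx H1] /andP[p2 /Hx H2] ->.
  rewrite pairingDl !pairingZl; nra.
move=> Hx.
(* The value of [t] at which [l] is tight at [x - t *: v]: elements of [N] bound [t] from below,
   those of [P] from above. *)
pose c l := pairing l x / pairing l v.
have [||t [t0 tN tP]] := @cone_bounds N P c.
- move=> l; rewrite mem_filter => /andP[lv lH]; apply: divr_ge0; last exact: ltW.
  by apply: Hx; rewrite mem_cat mem_filter lH ltW.
- move=> l' l l'N lP; have := Hx (comb l l').
  rewrite mem_cat (_ : _ \in allpairs _ _ _); last by apply/allpairsP; exists (l, l').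
  rewrite orbT => /(_ isT); rewrite pairingDl !pairingZl.
  move: l'N lP; rewrite !mem_filter => /andP[n' _] /andP[p _] h.
  rewrite /c ler_ndivrMr // mulrAC ler_pdivrMr //; lra.
exists t; split=> //; apply/HV => l lH.
rewrite -scaleNr pairingDr pairingZr mulNr subr_ge0.
have [lv|lv|lv] := ltgtP (pairing l v) 0.
- have := tN l; rewrite mem_filter lv lH => /(_ isT).
  by rewrite /c ler_ndivrMr.
- have := tP l; rewrite mem_filter lv lH => /(_ isT).
  by rewrite /c ler_pdivlMr.
- rewrite lv mulr0; apply: Hx; by rewrite mem_cat mem_filter lH lv lexx.
Qed.

Lemma cone_sumP (V : seq 'rV[R]_m) (y : E) : cone [seq (u, 1) | u <- V] y <->
  exists (n : nat) (w : 'I_n -> R) (p : 'I_n -> 'rV[R]_m),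
   [/\ forall i, 0 <= w i, forall i, p i \in V &
     y = (\sum_(i < n) w i *: p i, \sum_(i < n) w i)].
Proof.
elim: V y => [|v V IH] y /=.
  split=> [->|[[|n] [w [p [_ Hp ->]]]]]; last by have := Hp ord0.
    by exists 0%N, (fun=> 0), (fun=> 0); split=> [//|[]//|]; rewrite !big_ord0.
  by rewrite !big_ord0.
split.
  move=> [t [t0 /IH [n [w [p [w0 Hp Hy]]]]]].
  exists n.+1, (fun i => if unlift ord0 i is Some j then w j else t),
    (fun i => if unlift ord0 i is Some j then p j else v); split.
  - by move=> i; case: unliftP.
  - by move=> i; rewrite inE; case: unliftP => [j|] _; rewrite ?Hp ?eqxx ?orbT.
  have -> : y = t *: (v, 1) + (y - t *: (v, 1)) by rewrite addrCA subrr addr0.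
  rewrite Hy !big_ord_recl /= unlift_none.
  congr (_, _) => /=; [|rewrite /GRing.scale /= mulr1]; congr (_ + _);
    by apply: eq_bigr => i _; rewrite liftK.
move=> [n [w [p [w0 Hp ->]]]].
exists (\sum_(i | p i == v) w i); split; first exact: sumr_ge0.
apply/IH.
have [V0|[u0 u0V]] : (V = [::] \/ exists u0, u0 \in V).
    by case: (V) => [|u0 V']; [left|right; exists u0; rewrite mem_head].
  exists 0%N, (fun=> 0), (fun=> 0); split=> [//|[]//|]; rewrite !big_ord0.
  have pv i : p i == v by have := Hp i; rewrite V0 inE.
  rewrite [\sum_(i < n) w i *: _](eq_bigr (fun i => w i *: v)); last first.
    by move=> i _; rewrite (eqP (pv i)).
  rewrite -scaler_suml.
  have -> : \sum_(i | p i == v) w i = \sum_i w i by apply: eq_bigl => i; rewrite pv.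
  congr (_, _) => /=; first by rewrite subrr.
  by rewrite [X in _ - X]mulr1 subrr.
(* Indices carrying [v] get weight 0 and the dummy point [u0], since every index must still carry a
   point of [V]. *)
exists n, (fun i => if p i == v then 0 else w i),
  (fun i => if p i == v then u0 else p i); split.
- by move=> i; case: ifP.
- by move=> i; case: ifP => // /negPf pv; have := Hp i; rewrite inE pv.
congr (_, _) => /=.
  rewrite (bigID (fun i => p i == v)) /= [RHS](bigID (fun i => p i == v)) /=.
  rewrite scaler_suml addrAC [X in X + _](_ : _ = 0); last first.
    apply/eqP; rewrite subr_eq0; apply/eqP/eq_bigr => i /eqP->//.
  rewrite [X in _ = X + _]big1 => [|i ->]; last by rewrite scale0r.
  by congr (_ + _); apply: eq_bigr => i /negPf->.
rewrite (bigID (fun i => p i == v)) /= [RHS](bigID (fun i => p i == v)) /=.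
rewrite /GRing.scale /= mulr1 addrAC subrr.
rewrite [X in _ = X + _]big1 => [|i ->//].
by congr (_ + _); apply: eq_bigr => i /negPf->.
Qed.

(** A point [u] lies in the polytope exactly when [(u, 1)] lies in the cone over the points of [V]
    lifted to height 1. *)
Lemma polytope_hrep (V : seq 'rV[R]_m) : (forall u, u \in V -> rat_pt u) ->
  exists H : seq E, (forall l, l \in H -> rat_aff l) /\
    forall u, conv (fun z => z \in V) u <-> forall l, l \in H -> 0 <= aff l u.
Proof.
move=> rV; have [|H [rH HV]] := @cone_hrep [seq (u, 1) | u <- V].
  by move=> _ /mapP[v /rV rv ->]; split=> //=; apply: (is_rat_nat _ 1).
exists H; split=> // x.
have -> : (forall l, l \in H -> 0 <= aff l x) <->
    (forall l, l \in H -> 0 <= pairing l (x, 1)).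
  by split=> Hl l /Hl; rewrite /pairing /aff /= mulr1.
rewrite -HV cone_sumP; split.
  by move=> [n [w [p [w0 [w1 [Sp ->]]]]]]; exists n, w, p; rewrite w1.
by move=> [n [w [p [w0 Hp [-> w1]]]]]; exists n, w, p.
Qed.

End HRepresentation.

(** * Norm estimates, lattice points in boxes, and supporting functions *)

Section Metric.
Variables (R : realType) (m : nat).
Implicit Types (a x y z : 'rV[R]_m) (l : 'rV[R]_m * R^o) (S : set 'rV[R]_m).

Definition norm1 x : R := \sum_i `|x 0 i|.

Lemma norm1_ge0 x : 0 <= norm1 x.
Proof. exact: sumr_ge0. Qed.

Lemma coord_le_norm1 x i : `|x 0 i| <= norm1 x.
Proof. by rewrite /norm1 (bigD1 i) //= lerDl sumr_ge0. Qed.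

Lemma norm1_le x (c : R) : (forall i, `|x 0 i| <= c) -> norm1 x <= m%:R * c.
Proof.
move=> Hx; rewrite -[m in m%:R]card_ord mulr_natl -sumr_const.
exact: ler_sum.
Qed.

Lemma norm1B x y : norm1 x <= norm1 (x - y) + norm1 y.
Proof.
rewrite -big_split; apply: ler_sum => i _ /=.
by rewrite -{1}[x 0 i](subrK (y 0 i)) !mxE ler_normD.
Qed.

Lemma dotR_norm1 a x : `|dotR a x| <= norm1 a * norm1 x.
Proof.
apply: le_trans (ler_norm_sum _ _ _) _.
rewrite mulr_suml; apply: ler_sum => i _.
by rewrite normrM ler_wpM2l // coord_le_norm1.
Qed.

Lemma aff_lipschitz l x y : aff l x <= aff l y + norm1 l.1 * norm1 (x - y).
Proof.
have := dotR_norm1 l.1 (x - y); rewrite dotRBr ler_norml /aff => /andP[_].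
by move=> H; lra.
Qed.

Lemma aff_norm1 l x : aff l x <= (norm1 l.1 + `|l.2 : R|) * (1 + norm1 x).
Proof.
have := aff_lipschitz l x 0; rewrite subr0 {2}/aff dotR0r add0r.
have := norm1_ge0 x; have := norm1_ge0 l.1; have := normr_ge0 (l.2 : R).
have := ler_norm (l.2 : R); move: (aff l x) (norm1 l.1) (norm1 x) => u v w.
move: (l.2 : R) => b; nra.
Qed.

Lemma interior_sub S x : interior_pt S x -> S x.
Proof. by move=> [e [e0]]; apply=> i; rewrite subrr normr0. Qed.

(** A small step from [x] against the gradient stays in [S] and strictly lowers the value of [l]. *)
Lemma interior_aff_gt0 l S x : (forall y, S y -> 0 <= aff l y) -> l.1 != 0 ->
  interior_pt S x -> 0 < aff l x.
Proof.
move=> Sl l0 [e [e0 He]].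
pose d := e / (norm1 l.1 + 1).
have n0 := norm1_ge0 l.1.
have d0 : 0 < d by rewrite divr_gt0 // ltr_wpDl.
have /Sl : S (x - d *: l.1).
  apply: He => i; rewrite !mxE addrAC subrr sub0r normrN normrM gtr0_norm //.
  rewrite /d mulrAC ltr_pdivrMr ?ltr_wpDl // ltr_pM2l //.
  by have := coord_le_norm1 l.1 i; lra.
rewrite /aff dotRBr dotRZr.
have : 0 < dotR l.1 l.1.
  have [i li] : exists i, l.1 0 i != 0.
    apply: contrapT => H; move/eqP: l0; apply; apply/rowP => i; rewrite mxE.
    by apply: contrapT => li; apply: H; exists i; apply/eqP.
  rewrite /dotR (bigD1 i) //= ltr_pwDl ?sumr_ge0 // => [|j _].
    by rewrite -expr2 exprn_even_gt0.
  by rewrite -expr2 sqr_ge0.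
move: d0; move: (dotR l.1 l.1) (dotR l.1 x) => u v; nra.
Qed.

Lemma aff_gt0_near (Phi : seq ('rV[R]_m * R^o)) x :
  (forall l, l \in Phi -> 0 < aff l x) ->
  exists e : R, 0 < e /\ forall y, (forall i, `|y 0 i - x 0 i| < e) ->
    forall l, l \in Phi -> 0 <= aff l y.
Proof.
elim: Phi => [_|l Phi IH Hl]; first by exists 1; split.
have [|e [e0 He]] := IH; first by move=> k kP; apply: Hl; rewrite inE kP orbT.
pose K := norm1 l.1 * m%:R + 1.
have K0 : 0 < K by rewrite ltr_wpDl // mulr_ge0 // norm1_ge0.
have l0 := Hl l (mem_head _ _).
pose e' := aff l x / K.
have e'0 : 0 < e' by rewrite divr_gt0.
exists (Num.min e e'); split=> [|y Hy k]; first by rewrite lt_min e0.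
rewrite inE => /orP[/eqP->|kP]; last first.
  by apply: He => // i; have := Hy i; rewrite lt_min => /andP[].
have := aff_lipschitz l x y.
have : norm1 (x - y) <= m%:R * e'.
  apply: norm1_le => i; rewrite !mxE distrC ltW //.
  by have := Hy i; rewrite lt_min => /andP[].
have : norm1 l.1 * (m%:R * e') <= aff l x.
  rewrite mulrA /e' mulrA ler_pdivrMr // mulrC ler_pM2l // /K; lra.
have := norm1_ge0 l.1; move: (norm1 l.1) (m%:R * e') (norm1 (x - y)) => u v w.
by move=> *; nra.
Qed.

Lemma int_box (B : nat) : exists Z : seq 'rV[R]_m,
  forall z, int_pt z -> (forall i, `|z 0 i| <= B%:R) -> z \in Z.
Proof.
pose row (g : {ffun 'I_m -> 'I_(2 * B).+1}) : 'rV[R]_m :=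
  \row_i ((g i : nat)%:R - B%:R).
exists (map row (enum {ffun 'I_m -> 'I_(2 * B).+1})) => z /choice[n Hn] zB.
have nB i : (- B%:Z <= n i <= B%:Z)%R.
  have := zB i; rewrite Hn ler_norml -[B%:R]/(B%:Z%:~R) -mulrNz !ler_int //.
apply/mapP; exists [ffun i => inord (absz (n i + B%:Z))]; first by rewrite mem_enum.
apply/rowP => i; rewrite mxE ffunE inordK; last by have := nB i; lia.
rewrite Hn natr_absz ger0_norm; last by have := nB i; lia.
by rewrite intrD addrK.
Qed.

Lemma polytope_bounded (V : seq 'rV[R]_m) : exists B : nat,
  forall x, conv (fun y => y \in V) x -> forall i, `|x 0 i| <= B%:R.
Proof.
have [M M0 HM] : exists2 M : R, 0 <= M & forall v, v \in V -> norm1 v <= M.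
  exists (\big[Num.max/0]_(v <- V) norm1 v); first exact: bigmax_ge_id.
  by move=> v vV; apply: le_bigmax_seq.
exists (Num.bound M) => _ [n [w [p [w0 [w1 [Sp ->]]]]]] i.
apply: le_trans (ltW (archi_boundP M0)).
rewrite summxE; apply: le_trans (ler_norm_sum _ _ _) _.
rewrite -[M]mul1r -w1 mulr_suml; apply: ler_sum => j _.
rewrite mxE normrM ger0_norm // ler_wpM2l //.
exact: le_trans (coord_le_norm1 _ _) (HM _ (Sp j)).
Qed.

(** The functions of a half-space description are divided by their values at [f]. Redundant box
    constraints are added so that far from the origin some function is negative, at a linear
    rate. *)
Lemma support_family (V : seq 'rV[R]_m) (f : 'rV[R]_m) :
  (0 < m)%N -> (forall v, v \in V -> rat_pt v) -> rat_pt f ->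
  interior_pt (conv (fun y => y \in V)) f ->
  exists Phi : seq ('rV[R]_m * R^o),
  [/\ forall l, l \in Phi -> rat_aff l, forall l, l \in Phi -> aff l f = 1,
    forall x, conv (fun y => y \in V) x <-> forall l, l \in Phi -> 0 <= aff l x &
    exists A kappa : R, 0 < kappa /\
      forall x, exists2 l, l \in Phi & aff l x <= A - kappa * norm1 x].
Proof.
move=> m0 rV rf fint.
have [H0 [rH0 HH0]] := polytope_hrep rV.
have [B HB] := polytope_bounded V.
pose bx (i : 'I_m) (s : bool) : 'rV[R]_m * R^o := ((-1) ^+ s *: delta_mx 0 i, B.+1%:R).
have bxE i s x : aff (bx i s) x = (-1) ^+ s * x 0 i + B.+1%:R.
  by rewrite /aff /= dotRZl dotR_delta.
have B1 : (B.+1%:R = B%:R + 1 :> R) by rewrite -natr1.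
pose H := H0 ++ [seq bx i s | i <- enum 'I_m, s <- [:: true; false]].
have rH l : l \in H -> rat_aff l.
  rewrite mem_cat => /orP[/rH0//|/allpairsP[[i s] /= [_ _ ->]]].
  split; last exact: is_rat_nat.
  move=> j; rewrite !mxE; apply: is_ratM; last exact: is_rat_nat.
  exists ((-1) ^+ s); by rewrite rmorphXn rmorphN1.
have bx0 i s x : conv (fun y => y \in V) x -> 0 <= aff (bx i s) x.
  move=> /HB/(_ i); rewrite bxE ler_norml => /andP[? ?].
  by case: s; rewrite ?expr1 ?expr0; lra.
have HH x : conv (fun y => y \in V) x <-> forall l, l \in H -> 0 <= aff l x.
  split=> [Lx l|Hx]; last by apply/HH0 => l lH; apply: Hx; rewrite mem_cat lH.
  rewrite mem_cat => /orP[/(proj1 (HH0 x) Lx)//|/allpairsP[[i s] /= [_ _ ->]]].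
  exact: bx0.
have Hf l : l \in H -> l.1 != 0 -> 0 < aff l f.
  by move=> lH l0; apply: interior_aff_gt0 l0 fint => y /HH; apply.
pose nrm l := (aff l f)^-1 *: l.
exists [seq nrm l | l <- H & l.1 != 0]; split.
- move=> k /mapP[l]; rewrite mem_filter => /andP[_ lH] ->.
  by apply: rat_affZ; [apply: is_ratV; apply: rat_aff_val|]; rewrite //; apply: rH.
- move=> k /mapP[l]; rewrite mem_filter => /andP[l0 lH] ->.
  by rewrite affZ mulVf // gt_eqF // Hf.
- move=> x; rewrite HH; split=> Hx l.
    move=> /mapP[k]; rewrite mem_filter => /andP[k0 kH] ->.
    by rewrite affZ mulr_ge0 ?Hx // invr_ge0 ltW // Hf.
  move=> lH; have [l0|l0] := eqVneq l.1 0.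
    have := proj1 (HH f) (interior_sub fint) l lH.
    by rewrite /aff l0 !dotR0l.
  have := Hx (nrm l); rewrite affZ pmulr_rge0 ?invr_gt0 ?Hf //; apply.
  by apply/mapP; exists l; rewrite // mem_filter l0.
have fB i : `|f 0 i| <= B%:R by apply: HB; apply: interior_sub.
(* [D] bounds the box functions at [f], so their normalised forms have slope at least [1 / D] in
   absolute value. *)
pose D : R := 2 * B%:R + 1.
have B0 : 0 <= B%:R :> R by [].
have D0 : 0 < D by rewrite /D; lra.
pose A := 2 + norm1 f / D.
have mR : 0 < m%:R :> R by rewrite ltr0n.
(* If all functions exceeded the bound at [x], summing the box constraints over the coordinates
   would contradict [norm1 x <= norm1 (x - f) + norm1 f]. *)
exists A, (m%:R * D)^-1; split; first by rewrite invr_gt0 mulr_gt0.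
move=> x; apply: contrapT => Hx.
have {}Hx i : A - (m%:R * D)^-1 * norm1 x <= 1 - `|x 0 i - f 0 i| / D.
  rewrite leNgt; apply/negP => Hi; apply: Hx.
  (* The sign for which the box function decreases as coordinate [i] moves from [f] to [x]. *)
  pose s := (f 0 i <= x 0 i).
  have bH : bx i s \in H.
    rewrite mem_cat; apply/orP; right; apply/allpairsP; exists (i, s).
    by rewrite mem_enum; case: (s).
  have b0 : (bx i s).1 != 0.
    apply/eqP => /rowP/(_ i); rewrite !mxE !eqxx mulr1 => /eqP.
    by rewrite signr_eq0.
  exists (nrm (bx i s)); first by apply/mapP; exists (bx i s); rewrite ?mem_filter ?b0.
  apply: le_trans (ltW Hi); rewrite affZ.
  have fp := Hf _ bH b0.
  rewrite mulrC ler_pdivrMr //.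
  have E1 : aff (bx i s) x = aff (bx i s) f - `|x 0 i - f 0 i|.
    by rewrite !bxE /s; case: lerP => h; rewrite ?expr1 ?expr0; lra.
  have E2 : aff (bx i s) f <= D.
    rewrite bxE /D; have := fB i; rewrite ler_norml => /andP[? ?].
    by case: (s); rewrite ?expr1 ?expr0; lra.
  rewrite E1; move: fp E2; move: (aff _ f) => q q0 qD.
  have : `|x 0 i - f 0 i| / D * q <= `|x 0 i - f 0 i|.
    by rewrite mulrAC ler_pdivrMr // ler_wpM2l.
  by move=> ?; lra.
have : \sum_(i < m) (A - (m%:R * D)^-1 * norm1 x) <= \sum_(i < m) (1 - `|x 0 i - f 0 i| / D).
  by apply: ler_sum.
rewrite sumr_const card_ord -[X in X <= _]mulr_natl sumrB sumr_const card_ord -mulr_suml.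
have -> : \sum_(i < m) `|x 0 i - f 0 i| = norm1 (x - f).
  by apply: eq_bigr => i _; rewrite !mxE.
have -> : m%:R * (A - (m%:R * D)^-1 * norm1 x) = m%:R * A - norm1 x / D.
  by field; rewrite !gt_eqF.
have := norm1B x f; rewrite -(ler_pM2r (x := D^-1)) ?invr_gt0 // mulrDl /A.
have : 0 <= norm1 f / D by rewrite divr_ge0 ?norm1_ge0 // ltW.
have : 1 <= m%:R :> R by rewrite ler1n.
move: mR (norm1 f / D) (norm1 x / D) (norm1 (x - f) / D) => mR u v w; move: (m%:R : R) => M.
by move=> *; nra.
Qed.

End Metric.

Lemma seq_argmin (R : realType) (T : eqType) (s : seq T) (F : T -> R) (x0 : T) : x0 \in s ->
  exists2 x, x \in s & forall y, y \in s -> F x <= F y.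
Proof.
elim: s x0 => [//|a s IH] x0 _.
case: s IH => [_|b s IH]; first by exists a; rewrite ?mem_head // => y; rewrite inE => /eqP->.
have [x xs Hx] := IH b (mem_head _ _).
have [h|h] := leP (F a) (F x).
  exists a; rewrite ?mem_head // => y; rewrite inE => /orP[/eqP->//|/Hx]; exact: le_trans.
exists x; first by rewrite inE xs orbT.
by move=> y; rewrite inE => /orP[/eqP->|/Hx//]; apply: ltW.
Qed.

Lemma count_ltn (T : eqType) (s : seq T) (a b : pred T) (x : T) :
  {in s, forall y, a y -> b y} -> x \in s -> ~~ a x -> b x -> (count a s < count b s)%N.
Proof.
move=> ab xs nax bx; rewrite -!size_filter.
have -> : [seq y <- s | a y] = [seq y <- [seq y <- s | b y] | a y].
  rewrite -filter_predI; apply: eq_in_filter => y ys /=.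
  by case ay: (a y) => //=; rewrite (ab y ys ay).
rewrite [X in (X < _)%N]size_filter -(count_predC a [seq y <- s | b y]).
rewrite -addn1 leq_add2l -has_count; apply/hasP; exists x => //=.
by rewrite mem_filter bx.
Qed.

(** * A facet through a given boundary point *)

Section Facets.
Variables (R : realType) (m : nat).
Implicit Types (u : 'rV[R]_(m + 1)) (x v : 'rV[R]_m) (T V : seq 'rV[R]_m).

(** Encoding affine functions as rows of length [m + 1] makes kernels and ranks applicable. *)
Definition aff_of_row u : 'rV[R]_m * R^o := (lsubmx u, u 0 (rshift m 0)).

Lemma aff_of_rowD u u' x : aff (aff_of_row (u + u')) x = aff (aff_of_row u) x + aff (aff_of_row u') x.
Proof. by rewrite /aff /aff_of_row /= linearD dotRDl !mxE; ring. Qed.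

Lemma aff_of_rowZ c u x : aff (aff_of_row (c *: u)) x = c * aff (aff_of_row u) x.
Proof. by rewrite /aff /aff_of_row /= linearZ dotRZl !mxE /=; ring. Qed.

Lemma aff_of_row_mul u x : (u *m (row_mx x (const_mx 1 : 'rV_1))^T) 0 0 = aff (aff_of_row u) x.
Proof.
rewrite mxE big_split_ord /= big_ord1; congr (_ + _).
  by apply: eq_bigr => i _; rewrite [_^T _ _]mxE row_mxEl /= [in RHS]mxE.
by rewrite [_^T _ _]mxE row_mxEr mxE mulr1.
Qed.

Lemma aff_of_row_mx (l : 'rV[R]_m * R^o) : aff_of_row (row_mx l.1 (const_mx l.2)) = l.
Proof. by case: l => a b; rewrite /aff_of_row row_mxKl row_mxEr mxE. Qed.

(** The points in homogeneous coordinates: the rank counts affinely independent points, and the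
    functions vanishing on [T] form a kernel. *)
Definition hommx T := \matrix_(i < size T) row_mx (nth 0 T i) (const_mx 1 : 'rV[R]_1).

Lemma hommx_kerP T u : u *m (hommx T)^T = 0 <-> forall v, v \in T -> aff (aff_of_row u) v = 0.
Proof.
have E (i : 'I_(size T)) : (u *m (hommx T)^T) 0 i = aff (aff_of_row u) (nth 0 T i).
  rewrite -aff_of_row_mul !mxE; apply: eq_bigr => j _.
  by rewrite /hommx !mxE.
split=> [H v /(nthP 0)[i iT <-]|H].
  by rewrite -(E (Ordinal iT)) H mxE.
by apply/rowP => i; rewrite E H ?mxE // mem_nth.
Qed.

Lemma hommx_aff_indep T (S : set 'rV[R]_m) : (forall v, v \in T -> S v) ->
  has_aff_indep S (\rank (hommx T)).
Proof.
move=> TS; exists (fun i => nth 0 T (maxrankfun (hommx T) i)); split=> [i|].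
  by apply: TS; rewrite mem_nth.
have := maxrowsub_free (hommx T).
by congr (is_true (row_free _)); apply/matrixP => i j; rewrite /hommx !mxE.
Qed.

Lemma aff_of_row_eq0 (L : set 'rV[R]_m) f u :
  interior_pt L f -> (forall x, L x -> aff (aff_of_row u) x = 0) -> u = 0.
Proof.
move=> fint H.
have u1 : (aff_of_row u).1 = 0.
  apply: contrapT => /eqP u0.
  have : 0 < aff (aff_of_row u) f by apply: interior_aff_gt0 u0 fint => y /H->.
  by rewrite (H f (interior_sub fint)) ltxx.
have := H f (interior_sub fint); rewrite /aff u1 dotR0l add0r /= => u2.
apply/rowP => i; rewrite mxE -[i]splitK; case: (split i) => j /=.
  by have /rowP/(_ j) := u1; rewrite !mxE.
by rewrite ord1.
Qed.

(** Among the nonzero functions nonnegative on [V] and vanishing at [p], one with the most tight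
    generators defines a facet: if these generators had rank below [m], the function could be
    rotated about them until another generator became tight. *)
Lemma facet_through V (f p : 'rV[R]_m) (l0 : 'rV[R]_m * R^o) (L : set 'rV[R]_m) :
  (0 < m)%N -> L = conv (fun y => y \in V) -> interior_pt L f ->
  (forall x, L x -> 0 <= aff l0 x) -> l0 != 0 -> L p -> aff l0 p = 0 ->
  exists G, facet L G /\ G p.
Proof.
move=> m0 LV fint Ll0 l00 Lp l0p.
have VL v : v \in V -> L v by move=> vV; rewrite LV; apply: sub_conv.
pose A u := aff (aff_of_row u).
pose Sup u := [/\ u != 0, forall v, v \in V -> 0 <= A u v & A u p = 0].
pose tight u := [pred v | A u v == 0].
pose P k := `[< exists2 u, Sup u & count (tight u) V = k >].
have exP : exists k, P k.
  exists (count (tight (row_mx l0.1 (const_mx l0.2))) V); apply/asboolP.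
  exists (row_mx l0.1 (const_mx l0.2)) => //; split.
  - apply/eqP => H; move/eqP: l00; apply; rewrite -(aff_of_row_mx l0) H.
    by rewrite /aff_of_row linear0 mxE.
  - by move=> v /VL; rewrite /A aff_of_row_mx; apply: Ll0.
  - by rewrite /A aff_of_row_mx.
have ubP k : P k -> (k <= size V)%N.
  by move=> /asboolP[u _ <-]; apply: count_size.
case: (ex_maxnP exP ubP) => k /asboolP[u [u0 uV up] uk] kmax {exP ubP}.
have uL x : L x -> 0 <= A u x by rewrite LV; apply: aff_conv_ge0.
pose T := filter (tight u) V.
have uT : u *m (hommx T)^T = 0.
  by apply/hommx_kerP => v; rewrite mem_filter => /andP[/eqP].
pose G := [set x | L x /\ A u x = 0].
have rk_lt (n : nat) (Q : 'M[R]_(n, m + 1)) : u *m Q^T = 0 -> (\rank Q <= m)%N.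
  move=> uQ; rewrite leqNgt; apply/negP => rQ; move/eqP: u0; apply.
  apply/eqP; rewrite -(@mulmx_free_eq0 _ _ _ _ u Q^T) ?uQ //.
  by rewrite /row_free mxrank_tr; have := rank_leq_col Q; lia.
have rkT : \rank (hommx T) = m.
  apply/eqP; rewrite eqn_leq rk_lt //= leqNgt; apply/negP => rT.
  (* The kernel has dimension at least two, so [u] does not span it. *)
  have [i Hi] : exists i, ~~ (row i (kermx (hommx T)^T) <= u)%MS.
    apply/row_subPn; apply/negP => /mxrankS.
    by rewrite mxrank_ker mxrank_tr; have := rank_leq_row u; lia.
  set u' := row i _ in Hi.
  have u'T : u' *m (hommx T)^T = 0 by apply/sub_kermxP; exact: row_sub.
  have [v vV u'v] : exists2 v, v \in V & A u' v != 0.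
    apply: contrapT => H; move/negP: Hi; apply.
    rewrite (_ : u' = 0) ?sub0mx //; apply: (aff_of_row_eq0 fint) => x.
    rewrite LV => -[n [w [q [w0 [w1 [Vq ->]]]]]].
    rewrite aff_sum // big1 // => j _.
    apply/eqP; rewrite mulf_eq0; apply/orP; right; apply/negPn/negP => h.
    by apply: H; exists (q j) => //; apply: Vq.
  (* [u'] is negated if necessary, so as to be negative at some generator. *)
  have [u2 [Hu2 u2T [v2 v2V u2v]]] : exists u2, [/\ ~~ (u2 <= u)%MS,
      u2 *m (hommx T)^T = 0 & exists2 v, v \in V & A u2 v < 0].
    case: (ltP (A u' v) 0) => h; first by exists u'; split=> //; exists v.
    exists ((-1) *: u'); split.
    - by rewrite scaleN1r eqmx_opp.
    - by rewrite -scalemxAl u'T scaler0.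
    - by exists v => //; rewrite /A aff_of_rowZ mulN1r oppr_lt0 lt_neqAle eq_sym u'v.
  pose N := [seq v <- V | A u2 v < 0].
  have [|v3 v3N v3min] := @seq_argmin _ _ N (fun v => A u v / - A u2 v) v2.
    by rewrite mem_filter u2v.
  move: (v3N); rewrite mem_filter => /andP[u2v3 v3V].
  (* The ratio test: the largest [t] keeping [u + t *: u2] nonnegative on [V]; it makes [v3]
     tight. *)
  pose t := A u v3 / - A u2 v3.
  have t0 : 0 <= t by rewrite divr_ge0 ?uV // oppr_ge0 ltW.
  pose u3 := u + t *: u2.
  have u3E x : A u3 x = A u x + t * A u2 x by rewrite /A aff_of_rowD aff_of_rowZ.
  have Tu2 x : x \in V -> A u x = 0 -> A u2 x = 0.
    move=> xV ux; have /hommx_kerP := u2T; apply; rewrite mem_filter xV andbT.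
    exact/eqP.
  have S3 : Sup u3.
    split.
    - apply/eqP => H; move/negP: Hu2; apply.
      have t1 : t != 0.
        by apply/eqP => t1; move: H u0; rewrite /u3 t1 scale0r addr0 => ->; rewrite eqxx.
      have -> : u2 = (- t^-1) *: u.
        rewrite -[u in RHS]addr0 -[0 in RHS](subrr (t *: u2)) addrA (H : u + t *: u2 = 0) sub0r.
        by rewrite scalerN scaleNr opprK scalerA mulVf // scale1r.
      exact: scalemx_sub.
    - move=> x xV; rewrite u3E.
      case: (ltP (A u2 x) 0) => h; last by rewrite addr_ge0 ?uV // mulr_ge0.
      have := v3min x; rewrite mem_filter h xV => /(_ isT); rewrite -/t.
      by rewrite ler_pdivlMr ?oppr_gt0 //; lra.
    (* The generators of positive weight in [p] are tight for [u], and there [u2] vanishes too. *)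
    - rewrite u3E up add0r; suff -> : A u2 p = 0 by rewrite mulr0.
      move: (Lp) up; rewrite LV => -[n [w [q [w0 [w1 [Vq ->]]]]]] uq.
      have qV j : q j \in V := Vq j.
      have := aff_eq0_summand w0 w1 (fun j => uV _ (qV j)) uq.
      move=> H; rewrite /A aff_sum // big1 // => j _.
      by have [->|/(Tu2 _ (qV j)) h] := H j; [rewrite mul0r|rewrite [aff _ _]h mulr0].
  have := kmax (count (tight u3) V).
  have -> : P (count (tight u3) V) by apply/asboolP; exists u3.
  move=> /(_ isT); rewrite -uk leqNgt => /negP; apply.
  apply: (@count_ltn _ _ _ _ v3) => //.
  - move=> y yV /eqP uy; rewrite /tight /= u3E (Tu2 y yV uy) mulr0 addr0.
    by apply/eqP; exact: uy.
  - apply/negP => /eqP /(Tu2 _ v3V) h; by move: u2v3; rewrite h ltxx.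
  - rewrite /tight /= u3E /t.
    have n0 : A u2 v3 != 0 by rewrite lt_eqF.
    by apply/eqP; field.
exists G; split; last by split.
split.
  exists (- (aff_of_row u).1), ((aff_of_row u).2 : R); split.
    by move=> x /uL; rewrite /A /aff dotRNl; lra.
  apply/seteqP; split=> x [Lx ux]; split=> //; move: ux; rewrite /A /aff dotRNl; lra.
(* [L] has dimension [m], as no nonzero affine function vanishes on [V]; [G] has dimension [m - 1],
   by the rank of the tight generators and because [u] vanishes on [G]. *)
exists m.-1; split; split; rewrite prednK //.
- have <- : \rank (hommx V) = m.+1.
    have rV1 : (\rank (hommx V) <= m.+1)%N by have := rank_leq_col (hommx V); lia.
    apply/eqP; rewrite eqn_leq rV1 ltnNge; apply/negP => rV.
    have : \rank (kermx (hommx V)^T) = 0%N.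
      apply/eqP; rewrite mxrank_eq0; apply/eqP/row_matrixP => i; rewrite row0.
      apply: (aff_of_row_eq0 fint) => x.
      rewrite LV => -[n [w [q [w0 [w1 [Vq ->]]]]]].
      rewrite aff_sum // big1 // => j _.
      have /hommx_kerP -> : row i (kermx (hommx V)^T) *m (hommx V)^T = 0.
        by apply/sub_kermxP; exact: row_sub.
      by rewrite mulr0.
      exact: Vq.
    by rewrite mxrank_ker mxrank_tr; lia.
  exact: hommx_aff_indep.
- move=> [q [_ /eqP]]; have := rank_leq_col (\matrix_(i < m.+2) row_mx (q i) (const_mx 1 : 'rV[R]_1)).
  by lia.
- have : has_aff_indep G (\rank (hommx T)); last by rewrite rkT.
  apply: hommx_aff_indep => v; by rewrite mem_filter => /andP[/eqP uv /VL Lv]; split.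
- move=> [q [Gq /eqP rq]].
  have := rk_lt _ (\matrix_(i < m.+1) row_mx (q i) (const_mx 1 : 'rV[R]_1)).
  rewrite rq ltnn => h; suff: false by []; apply: h.
  apply/rowP => i; rewrite [RHS]mxE.
  transitivity (A u (q i)); last by have [] := Gq i.
  rewrite /A -aff_of_row_mul !mxE; apply: eq_bigr => j _; by rewrite !mxE.
Qed.

End Facets.

(** * A polytope as the hull of its vertices *)

Section Vertices.
Variables (R : realType) (m : nat).
Implicit Types (x v w : 'rV[R]_m) (V W : seq 'rV[R]_m).

Lemma minimal_generators V : exists W, [/\ {subset W <= V},
  conv (fun y => y \in W) = conv (fun y => y \in V) &
  forall w, w \in W -> ~ conv (fun y => y \in [seq z <- W | z != w]) w].
Proof.
have [n] := ubnP (size V); elim: n V => // n IH V; rewrite ltnS => Vn.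
have [[v [vV Hv]]|H] := pselect (exists v, v \in V /\
    conv (fun y => y \in [seq z <- V | z != v]) v); last first.
  by exists V; split=> // w wV Hw; apply: H; exists w.
pose V' := [seq z <- V | z != v].
have [|W [WV' WE Wmin]] := IH V'.
  apply: leq_trans Vn; rewrite -(count_predC (fun z => z != v) V) size_filter.
  by rewrite -addn1 leq_add2l -has_count; apply/hasP; exists v; rewrite //= eqxx.
exists W; split=> //.
  by move=> w /WV'; rewrite mem_filter => /andP[].
rewrite WE; apply/seteqP; split.
  by apply: conv_mono => x /=; rewrite mem_filter => /andP[].
move=> x Vx; apply: (@convex_conv _ _ _); apply: conv_mono Vx => y yV.
have [->//|yv] := eqVneq y v.
by apply: sub_conv; rewrite mem_filter yv.
Qed.

(** Every point [w] of a minimal generating list is a vertex: an inequality separating [w] from the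
    hull of the others, translated to pass through [w], holds on the polytope with equality only at
    [w]. *)
Lemma conv_vertices V : (forall v, v \in V -> rat_pt v) ->
  conv (fun y => y \in V) `<=` conv (vertex (conv (fun y => y \in V))).
Proof.
move=> rV; have [W [WV WE Wmin]] := minimal_generators V.
rewrite -{1}WE; apply: conv_mono => w wW.
have [|H [_ HH]] := @polytope_hrep R m [seq z <- W | z != w].
  by move=> v; rewrite mem_filter => /andP[_ /WV /rV].
have [l lH lw] : exists2 l, l \in H & aff l w < 0.
  apply: contrapT => h; apply: (Wmin w wW); apply/HH => l lH.
  by rewrite leNgt; apply/negP => lw; apply: h; exists l.
have lW v : v \in W -> v != w -> 0 <= aff l v.
  move=> vW vw; apply: (proj1 (HH v)) => //.
  by apply: sub_conv; rewrite mem_filter vw.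
pose l' : 'rV[R]_m * R^o := (l.1, - dotR l.1 w).
have l'E v : aff l' v = aff l v - aff l w by rewrite /aff /=; lra.
have l'W v : v \in W -> 0 <= aff l' v.
  move=> vW; rewrite l'E; have [->|/(lW v vW)] := eqVneq v w; first by rewrite subrr.
  by lra.
rewrite -WE; exists (- l.1), (- dotR l.1 w); split.
  move=> x Wx; have := aff_conv_ge0 l'W Wx; rewrite /aff /= dotRNl; lra.
apply/seteqP; split=> x.
  by move=> ->; split; [apply: sub_conv|rewrite dotRNl].
move=> [[n [c [q [c0 [c1 [Wq ->]]]]]]]; rewrite dotRNl => /oppr_inj E.
have E0 : aff l' (\sum_(i < n) c i *: q i) = 0 by rewrite /aff /= E subrr.
have H0 := aff_eq0_summand c0 c1 (fun i => l'W _ (Wq i)) E0.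
rewrite /= -[w]scale1r -c1 scaler_suml; apply: eq_bigr => i _.
have [->|] := H0 i; first by rewrite !scale0r.
rewrite l'E; have [->//|qw] := eqVneq (q i) w.
by move=> /subr0_eq h; have := lW _ (Wq i) qw; rewrite h leNgt lw.
Qed.

End Vertices.

(** * Split closures: convexity, monotonicity and mixed-integer points *)

Section SplitClosures.
Variables (R : realType) (m k : nat).
Let XS := ('rV[R]_m * 'rV[R]_k)%type.
Implicit Types (Q : set XS) (z : XS).

Lemma fst_sum (I : finType) (w : I -> R) (p : I -> XS) :
  (\sum_i w i *: p i).1 = \sum_i w i *: (p i).1.
Proof. exact: (big_morph fst (fun _ _ => erefl) erefl). Qed.

Lemma snd_sum (I : finType) (w : I -> R) (p : I -> XS) :
  (\sum_i w i *: p i).2 = \sum_i w i *: (p i).2.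
Proof. exact: (big_morph snd (fun _ _ => erefl) erefl). Qed.

Lemma convex_relaxP (f : 'rV[R]_m) (r : 'I_k -> 'rV[R]_m) : convex (relaxP f r).
Proof.
move=> _ [n [w [p [w0 [w1 [Pp ->]]]]]]; split=> [j|].
  rewrite snd_sum summxE; apply: sumr_ge0 => i _; rewrite mxE.
  by apply: mulr_ge0 => //; have [] := Pp i.
rewrite fst_sum snd_sum.
rewrite (eq_bigr (fun i => w i *: f + \sum_j (w i * (p i).2 0 j) *: r j)); last first.
  move=> i _; have [_ ->] := Pp i; rewrite scalerDr scaler_sumr; congr (_ + _).
  by apply: eq_bigr => j _; rewrite scalerA.
rewrite big_split /= -scaler_suml w1 scale1r exchange_big /=; congr (_ + _).
apply: eq_bigr => j _; rewrite -scaler_suml summxE; congr (_ *: _).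
by apply: eq_bigr => i _; rewrite mxE.
Qed.

Definition side (pi : 'rV[int]_m) (pi0 : int) z :=
  dotR (intvecR R pi) z.1 <= pi0%:~R \/ pi0%:~R + 1 <= dotR (intvecR R pi) z.1.

Lemma split_hullE Q pi pi0 :
  split_hull Q pi pi0 = conv [set z | Q z /\ side pi pi0 z].
Proof.
congr conv; apply/seteqP; split=> z; first by case=> -[Qz h]; split=> //; [left|right].
by move=> [Qz [h|h]]; [left|right].
Qed.

Lemma split_closure_sub Q : convex Q -> split_closure Q `<=` Q.
Proof.
move=> cQ z /(_ 0 0); rewrite split_hullE => Hz; apply: cQ.
by apply: conv_mono Hz => y [].
Qed.

Lemma convex_split_closure Q : convex (split_closure Q).
Proof.
move=> z Hz pi pi0; rewrite split_hullE; apply: convex_conv.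
by apply: conv_mono Hz => y /(_ pi pi0); rewrite split_hullE.
Qed.

Lemma convex_rank Q t : convex Q -> convex (rank_split_closure t Q).
Proof. by case: t => [//|t _]; apply: convex_split_closure. Qed.

Lemma rank_le Q s t : convex Q -> (s <= t)%N ->
  rank_split_closure t Q `<=` rank_split_closure s Q.
Proof.
move=> cQ /subnKC <-; elim: (t - s)%N => [|d IH]; first by rewrite addn0.
rewrite addnS => z Hz; apply: IH.
by apply: (split_closure_sub (@convex_rank _ _ cQ)).
Qed.

Lemma is_int_dotR (pi : 'rV[int]_m) (x : 'rV[R]_m) : int_pt x -> is_int (dotR (intvecR R pi) x).
Proof.
move=> /choice[n Hn]; exists (\sum_i pi 0 i * n i); rewrite rmorph_sum /=.
by apply: eq_bigr => i _; rewrite mxE Hn rmorphM.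
Qed.

Lemma is_int_side (c : R) (pi0 : int) : is_int c -> c <= pi0%:~R \/ pi0%:~R + 1 <= c.
Proof.
move=> [n ->]; rewrite -[1]/(1%:~R) -intrD !ler_int.
by have [h|h] := lerP n pi0; [left|right; lia].
Qed.

Lemma int_side pi pi0 z : int_pt z.1 -> side pi pi0 z.
Proof. by move=> zint; apply/is_int_side/is_int_dotR. Qed.

(** No integer point lies strictly between the hyperplanes of a split, so every round keeps the
    mixed-integer points. *)
Lemma mixed_rank (f : 'rV[R]_m) (r : 'I_k -> 'rV[R]_m) t z :
  mixed_set f r z -> rank_split_closure t (relaxP f r) z.
Proof.
move=> [Pz zint]; elim: t => [//|t IH] pi pi0.
by rewrite split_hullE; apply: sub_conv; split=> //; apply: int_side.
Qed.

End SplitClosures.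

(** * The gauge of [L - f] and lifts with small cut value *)

Section Gauge.
Variables (R : realType) (m k : nat) (L : set 'rV[R]_m) (f : 'rV[R]_m).
Hypothesis fint : interior_pt L f.

Lemma gauge_le r (t : R) : 0 < t -> L (f + t^-1 *: r) -> gauge L f r <= t.
Proof.
move=> t0 Lt; apply: ge_inf; last by split.
by exists 0 => s [/ltW].
Qed.

(** If [f + t^-1 *: r] lies in [L], then [aff l f = 1] gives [0 <= t + dotR l.1 r], a lower bound
    for every [t] in the infimum. *)
Lemma gauge_ge r l : (forall x, L x -> 0 <= aff l x) -> aff l f = 1 ->
  - dotR l.1 r <= gauge L f r.
Proof.
move=> Ll lf; apply: lb_le_inf.
  (* The set in the infimum must be nonempty: a small step from [f] along [r] stays in [L]. *)
  have [e [e0 He]] := fint.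
  pose t := (norm1 r + 1) / e.
  have n0 := norm1_ge0 r.
  have t0 : 0 < t by rewrite divr_gt0 // ltr_wpDl.
  exists t; split=> //; apply: He => i; rewrite !mxE addrAC subrr add0r normrM.
  rewrite gtr0_norm ?invr_gt0 // mulrC ltr_pdivrMr // /t mulrCA divff ?gt_eqF //.
  by have := coord_le_norm1 r i; rewrite mulr1; lra.
move=> t [t0 /Ll]; rewrite /aff dotRDr dotRZr addrAC -[dotR l.1 f + l.2]/(aff l f) lf => h.
rewrite lerNl; have : 0 <= (1 + t^-1 * dotR l.1 r) * t by rewrite mulr_ge0 // ltW.
by rewrite mulrDl mul1r mulrAC mulVf ?gt_eqF // mul1r; lra.
Qed.

Definition cutrow (r : 'I_k -> 'rV[R]_m) : 'rV[R]_k := \row_j gauge L f (r j).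

Lemma cutrowE r (s : 'rV[R]_k) :
  \sum_(j < k) gauge L f (r j) * s 0 j = dotR (cutrow r) s.
Proof. by apply: eq_bigr => j _; rewrite mxE. Qed.

Lemma cut_le_aff (r : 'I_k -> 'rV[R]_m) z l : (forall x, L x -> 0 <= aff l x) -> aff l f = 1 ->
  relaxP f r z -> 1 - dotR (cutrow r) z.2 <= aff l z.1.
Proof.
move=> Ll lf [s0 ->]; rewrite /aff dotRDr dotR_sumr addrAC -[dotR l.1 f + l.2]/(aff l f) lf.
rewrite lerD2l lerNl -sumrN; apply: ler_sum => j _.
by rewrite mxE -mulrN mulrC ler_wpM2r // gauge_ge.
Qed.

(** A vertex [f + lam *: r j] lifts to [lam] times the [j]-th unit vector, of cut value at most 1
    since the gauge of [r j] is at most [lam^-1]. Other points are convex combinations of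
    vertices. *)
Lemma vertex_lift (r : 'I_k -> 'rV[R]_m) (V : seq 'rV[R]_m) :
  (forall v, v \in V -> rat_pt v) -> L = conv (fun y => y \in V) ->
  rays_into_corners L f r ->
  forall x, L x -> exists2 s, relaxP f r (x, s) & dotR (cutrow r) s <= 1.
Proof.
move=> rV LV Hr x Lx.
have : conv (vertex L) x by move: Lx; rewrite LV; apply: conv_vertices.
move=> [n [w [p [w0 [w1 [vp ->]]]]]].
have /choice[s Hs] : forall i, exists s, relaxP f r (p i, s) /\ dotR (cutrow r) s <= 1.
  move=> i; have [j [lam [lam0 [E [_ nint]]]]] := Hr _ (vp i).
  have l0 : 0 < lam.
    rewrite lt_neqAle lam0 andbT; apply/eqP => l0; apply: nint.
    by rewrite E -l0 scale0r addr0.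
  exists (lam *: delta_mx 0 j); split.
    split=> [j'|] /=; first by rewrite !mxE mulr_ge0.
    rewrite E (bigD1 j) //= !mxE !eqxx mulr1 big1 ?addr0 // => j' jj'.
    by rewrite !mxE (negPf jj') andbF mulr0 scale0r.
  have : gauge L f (r j) <= lam^-1.
    apply: gauge_le; first by rewrite invr_gt0.
    by rewrite invrK -E; have [] := vp i => a [b [_ /seteqP[/(_ _ erefl)[]]]].
  rewrite -(ler_pM2l l0) mulfV ?gt_eqF // dotRZr.
  congr (_ * _ <= _); rewrite /dotR (bigD1 j) //= !mxE !eqxx mulr1 big1 ?addr0 // => j' jj'.
  by rewrite !mxE (negPf jj') andbF mulr0.
exists (\sum_i w i *: s i).
  have := @convex_sum _ _ _ _ w (fun i => (p i, s i)) (@convex_relaxP _ _ _ f r) w0 w1.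
  rewrite (_ : \sum_i w i *: (p i, s i) = (\sum_i w i *: p i, \sum_i w i *: s i)).
    by apply=> i; have [] := Hs i.
  by rewrite [LHS]surjective_pairing fst_sum snd_sum.
rewrite dotR_sumr -[X in _ <= X]w1; apply: ler_sum => i _.
by rewrite ler_piMr //; have [] := Hs i.
Qed.

(** Stretching [x] away from [f] by a factor [1 + d] stays in [L]; scaling the lift back by
    [(1 + d)^-1] brings its cut value below 1. *)
Lemma vertex_lift_interior (r : 'I_k -> 'rV[R]_m) (V : seq 'rV[R]_m) :
  (forall v, v \in V -> rat_pt v) -> L = conv (fun y => y \in V) ->
  rays_into_corners L f r ->
  forall x, interior_pt L x -> exists2 s, relaxP f r (x, s) & dotR (cutrow r) s < 1.
Proof.
move=> rV LV Hr x [e [e0 He]].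
have n0 := norm1_ge0 (x - f).
pose d := e / (norm1 (x - f) + 1).
have d0 : 0 < d by rewrite divr_gt0 // ltr_wpDl.
have Ly : L (x + d *: (x - f)).
  apply: He => i; rewrite mxE [(d *: (x - f)) _ _]mxE addrAC subrr add0r normrM gtr0_norm //.
  rewrite /d mulrAC ltr_pdivrMr ?ltr_wpDl // ltr_pM2l //.
  by have := coord_le_norm1 (x - f) i; lra.
have [s [s0 /= Es] cs] := vertex_lift rV LV Hr Ly.
have d1 : 0 < 1 + d by lra.
exists ((1 + d)^-1 *: s); last first.
  rewrite dotRZr mulrC ltr_pdivrMr // mul1r; lra.
split=> [j|] /=; first by rewrite mxE mulr_ge0 // invr_ge0 ltW.
under eq_bigr do rewrite mxE -scalerA.
rewrite -scaler_sumr.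
have -> : \sum_j s 0 j *: r j = (1 + d) *: (x - f).
  by apply: (addrI f); rewrite -Es scalerDl scale1r addrA [f + _]addrC subrK.
by rewrite scalerA mulVf ?gt_eqF // scale1r addrC subrK.
Qed.

End Gauge.

(** * Necessity: a violating point in every closure *)

Section Necessity.
Variables (R : realType) (m k : nat) (L : set 'rV[R]_m) (f : 'rV[R]_m).
Variables (r : 'I_k -> 'rV[R]_m).

(* A point of the [t]-th closure violating the cut survives one more round, with its
   violation divided by [n + 1]: if [v i] is at distance at least one beyond a boundary
   hyperplane of the split, then the midpoint of [v i] and the violating point is still
   outside the open strip. *)
Lemma split_step (n : nat) (v : 'I_n -> 'rV[R]_m * 'rV[R]_k) (a q : 'rV[R]_m * 'rV[R]_k)
    (eps : R) (Q : set ('rV[R]_m * 'rV[R]_k)) pi pi0 i :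
  convex Q -> (forall j, Q (v j)) -> (forall j, int_pt (v j).1) ->
  q = \sum_j n%:R^-1 *: v j ->
  Q ((1 - eps) *: q + eps *: a) ->
  side pi pi0 (2^-1 *: (v i + ((1 - eps) *: q + eps *: a))) ->
  split_hull Q pi pi0
    ((1 - eps / n.+1%:R) *: q + (eps / n.+1%:R) *: a).
Proof.
move=> cQ Qv vint Eq Qa Ha.
set b := (1 - eps) *: q + eps *: a in Qa Ha.
pose y := 2^-1 *: (v i + b).
have Qy : Q y.
  have := @convex_two _ _ _ (v i) b 2^-1 cQ _ (Qv i) Qa.
  rewrite (_ : 1 - 2^-1 = 2^-1) /y ?scalerDr; last by field.
  by apply; apply/andP; split; lra.
have n0 : (n%:R : R) != 0 by rewrite pnatr_eq0; case: (n) i {v Qv vint Eq Ha y Qy} => [[]|].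
have n1 : (n.+1%:R : R) = n%:R + 1 by rewrite -natr1.
have n1' : (n%:R + 1 : R) != 0 by rewrite -n1 pnatr_eq0.
have n10 : 0 <= (n%:R + 1 : R)^-1 by rewrite invr_ge0 -n1.
rewrite split_hullE.
(* The midpoint [y] replaces [v i] with double weight. *)
pose w (j : 'I_n) : R := (if j == i then 2 else 1) / (n%:R + 1).
pose p j := if j == i then y else v j.
have -> : (1 - eps / n.+1%:R) *: q + (eps / n.+1%:R) *: a = \sum_j w j *: p j.
  have Ev : n%:R *: q = \sum_j v j.
    by rewrite Eq -scaler_sumr scalerA mulfV // scale1r.
  rewrite (bigD1 i) //= /w /p eqxx (eq_bigr (fun j => (n%:R + 1)^-1 *: v j)); last first.
    by move=> j /negPf ->; rewrite mul1r.
  rewrite -scaler_sumr.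
  have -> : \sum_(j < n | j != i) v j = n%:R *: q - v i.
    by rewrite Ev [in RHS](bigD1 i) //= [v i + _]addrC addrK.
  rewrite /y /b n1.
  apply: (scalerI n1').
  rewrite !scalerDr !scalerN !scalerA.
  have -> : (n%:R + 1) * (2 / (n%:R + 1)) * 2^-1 = 1 :> R by field.
  have -> : (n%:R + 1) / (n%:R + 1) = 1 :> R by field.
  have -> : (n%:R + 1) * (1 - eps / (n%:R + 1)) = n%:R + (1 - eps) :> R by field.
  have -> : (n%:R + 1) * (eps / (n%:R + 1)) = eps :> R by field.
  rewrite !scale1r !mul1r scalerDl.
  by rewrite [RHS]addrC addrA subrK addrA.
apply: conv_fin.
- by move=> j; apply: mulr_ge0 => //; case: ifP.
- rewrite -mulr_suml (bigD1 i) //= eqxx (eq_bigr (fun=> 1)); last by move=> j /negPf->.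
  have : \sum_(j < n) (1 : R) = n%:R by rewrite sumr_const card_ord.
  rewrite (bigD1 i) //= => E.
  have -> : 2 + \sum_(j < n | j != i) (1 : R) = n%:R + 1 by rewrite -E; ring.
  by rewrite mulfV.
- move=> j; rewrite /p; case: ifP => _; first by split.
  by split=> //; apply: int_side.
Qed.

(** If [z] is at least one unit beyond the strip, its midpoint with [c] falls outside the open
    strip. *)
Lemma int_between (z pi0 : int) (c : R) : pi0%:~R < c -> c < pi0%:~R + 1 ->
  ~ (2^-1 * (z%:~R + c) <= pi0%:~R \/ pi0%:~R + 1 <= 2^-1 * (z%:~R + c)) ->
  z = pi0 \/ z = pi0 + 1.
Proof.
move=> c0 c1 H.
have h1 : (pi0 - 1)%:~R < z%:~R :> R.
  rewrite ltNge; apply/negP => h; apply: H; left; move: h; rewrite intrD mulrN1z; lra.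
have h2 : z%:~R < (pi0 + 2)%:~R :> R.
  by rewrite ltNge; apply/negP => h; apply: H; right; move: h; rewrite intrD; lra.
by rewrite !ltr_int in h1 h2; lia.
Qed.

Lemma finite_rank_two_hyperplane (V : seq 'rV[R]_m) : (0 < m)%N ->
  (forall v, v \in V -> rat_pt v) -> L = conv (fun y => y \in V) ->
  rat_pt f -> interior_pt L f -> rays_into_corners L f r ->
  Lcut_finite_split_rank L f r -> two_hyperplane_property L.
Proof.
move=> m0 rV LV rf fint Hr [T HT] F [a [b [ab EF]]] nF.
apply: contrapT => n2.
have cL : convex L by rewrite LV; apply: convex_conv.
have FL x : F x -> L x.
  by rewrite EF => -[+ _]; move=> H; apply: cL; apply: conv_mono H => y [].
have [B HB] := polytope_bounded V; have [Z0 HZ0] := @int_box R m B.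
pose Z := undup [seq z <- Z0 | `[< F z /\ int_pt z >]].
have ZP z : z \in Z <-> F z /\ int_pt z.
  rewrite mem_undup mem_filter; split=> [/andP[/asboolP]//|H]; apply/andP; split.
    exact/asboolP.
  by apply: HZ0; [case: H|apply: HB; rewrite -LV; apply: FL; case: H].
pose n := size Z.
pose v (i : 'I_n) := nth 0 Z i.
have vZ i : v i \in Z by apply: mem_nth.
have Zv z : z \in Z -> exists i, z = v i.
  by move=> /(nthP 0)[i iZ <-]; exists (Ordinal iZ).
have n0 : (0 < n)%N.
  rewrite lt0n; apply/negP => /eqP/size0nil Z0'; apply: n2; left=> x y [Fx ix] _.
  by have : x \in Z by [apply/ZP]; rewrite Z0'.
have nR : (n%:R : R) != 0 by rewrite pnatr_eq0 -lt0n.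
have w0 (i : 'I_n) : 0 <= (n%:R^-1 : R) by rewrite invr_ge0.
have w1 : \sum_(i < n) (n%:R^-1 : R) = 1.
  by rewrite sumr_const card_ord -[LHS]mulr_natr mulVf.
pose p := \sum_(i < n) n%:R^-1 *: v i.
have Lp : L p.
  by apply: convex_sum => // i; apply: FL; have [] := (proj1 (ZP _) (vZ i)).
(* Otherwise a supporting function vanishes at [p], so some facet contains [p], then every [v i],
   then [F]. *)
have pint : interior_pt L p.
  apply: contrapT => npint.
  have [Phi [rPhi fPhi LPhi _]] : exists Phi : seq ('rV[R]_m * R^o), _ :=
    support_family m0 rV rf (eq_ind _ (fun S => interior_pt S f) fint _ LV).
  rewrite -LV in LPhi.
  have [l lPhi lp] : exists2 l, l \in Phi & aff l p <= 0.
    apply: contrapT => h; apply: npint.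
    have [|e [e0 He]] := @aff_gt0_near _ _ Phi p.
      by move=> l lP; rewrite ltNge; apply/negP => lp; apply: h; exists l.
    by exists e; split=> // y /He Hy; apply/LPhi.
  have Ll x : L x -> 0 <= aff l x by move=> /LPhi; apply.
  have lp0 : aff l p = 0 by apply/eqP; rewrite eq_le lp Ll.
  have l0 : l != 0.
    apply/eqP => l0; have := fPhi l lPhi; rewrite l0 /aff dotR0l add0r.
    by move/eqP; rewrite eq_sym oner_eq0.
  have [G [facG Gp]] := facet_through m0 LV fint Ll l0 Lp lp0.
  apply: nF; exists G; split=> // x.
  have cG : convex G by apply: convex_face cL (proj1 facG).
  have GF z : F z -> int_pt z -> G z.
    move=> Fz iz; have [i ->] : exists i, z = v i by apply/Zv/ZP.
    move: Gp; have [[a' [b' [va' ->]]] _] := facG; move=> -[_ Ep].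
    pose l' : 'rV[R]_m * R^o := (- a', b').
    have l'E y : aff l' y = b' - dotR a' y by rewrite /aff /= dotRNl addrC.
    have vL j : L (v j) by apply: FL; have [] := (proj1 (ZP _) (vZ j)).
    have := @aff_eq0_summand _ _ l' _ _ v w0 w1 _ _ i.
    case.
    - by move=> j; rewrite l'E subr_ge0; apply: va'.
    - by rewrite l'E -/p Ep subrr.
    - by move/eqP; rewrite invr_eq0 (negPf nR).
    - by rewrite l'E => /subr0_eq.
  move=> Fx; apply: cG; move: (Fx); rewrite EF.
  move=> [[N [c [q [c0 [c1 [Sq ->]]]]]] Ea].
  pose l' : 'rV[R]_m * R^o := (- a, b).
  have l'E y : aff l' y = b - dotR a y by rewrite /aff /= dotRNl addrC.
  have H0 := @aff_eq0_summand _ _ l' _ _ q c0 c1 _ _.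
  have {}H0 i : c i = 0 \/ F (q i).
    case: (H0 _ _ i) => [j|||]; [|by rewrite l'E Ea subrr|by left|].
      by rewrite l'E subr_ge0; apply: ab; apply: sub_conv.
    by rewrite l'E => /subr0_eq E; right; rewrite EF; split=> //; apply: sub_conv.
  have [i0 Fi0] : exists i0, F (q i0).
    apply: contrapT => h; have := c1; rewrite big1 => [/eqP|i _].
      by rewrite eq_sym oner_eq0.
    by case: (H0 i) => // Fi; case: h; exists i.
  (* Points of weight zero may lie outside [F]; [q i0] takes their place. *)
  have -> : \sum_(i < N) c i *: q i =
      \sum_(i < N) c i *: (if pselect (F (q i)) then q i else q i0).
    apply: eq_bigr => i _; case: pselect => //= nFi.
    by case: (H0 i) => [->|//]; rewrite !scale0r.
  apply: conv_fin => // i; case: pselect => [Fi|_] /=; apply: GF => //.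
    by have [] := Sq i.
  by have [] := Sq i0.
have /choice[s Hs] : forall i, exists s, relaxP f r (v i, s) /\ dotR (cutrow L f r) s <= 1.
  move=> i; have [|s ? ?] := vertex_lift fint rV LV Hr (x := v i); last by exists s.
  by apply: FL; have [] := (proj1 (ZP _) (vZ i)).
have [sp Psp csp] := vertex_lift_interior fint rV LV Hr pint.
pose V' i := (v i, s i).
have vint i : int_pt (V' i).1 by have [] := (proj1 (ZP _) (vZ i)).
have V'Q t i : rank_split_closure t (relaxP f r) (V' i).
  by apply: mixed_rank; split; [have [] := Hs i|].
pose q := \sum_i n%:R^-1 *: V' i.
have q1 : q.1 = p by rewrite fst_sum.
have cP := @convex_relaxP R m k f r.
have Qq t : rank_split_closure t (relaxP f r) q.
  by apply: convex_sum => //; apply: convex_rank.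
(* Each round divides [eps] by [n + 1], the same for all splits, so the new point lies in the
   intersection over all of them. *)
have claim t : exists2 eps : R, 0 < eps <= 1 &
    rank_split_closure t (relaxP f r) ((1 - eps) *: q + eps *: (p, sp)).
  elim: t => [|t [eps /andP[e0 e1] He]].
    by exists 1; rewrite ?ltr01 ?lexx // subrr scale0r add0r scale1r.
  have n1 : (0 : R) < n.+1%:R by rewrite ltr0n.
  exists (eps / n.+1%:R).
    rewrite divr_gt0 //= ler_pdivrMr // mul1r.
    by apply: le_trans e1 _; rewrite ler1n.
  (* The new point lies between [q] and the previous one; this settles the splits whose open strip
     misses it. *)
  have He' : rank_split_closure t (relaxP f r)
      ((1 - eps / n.+1%:R) *: q + (eps / n.+1%:R) *: (p, sp)).
    have := convex_two (t := n.+1%:R^-1) (convex_rank (t := t) cP) _ (Qq t) He.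
    rewrite scalerDr !scalerA addrA -scalerDl [_^-1 * eps]mulrC.
    rewrite (_ : 1 - n.+1%:R^-1 + _ = 1 - eps / n.+1%:R); last by ring.
    by apply; rewrite invr_ge0 ltW //= invf_le1 // ler1n.
  have b1 c : ((1 - c) *: q + c *: (p, sp)).1 = p.
    by rewrite /= q1 -scalerDl subrK scale1r.
  move=> pi pi0.
  pose d x := dotR (intvecR R pi) x.
  have [sd|nsd] := pselect (side pi pi0 ((1 - eps / n.+1%:R) *: q + (eps / n.+1%:R) *: (p, sp))).
    by rewrite split_hullE; apply: sub_conv; split.
  have [dp0 dp1] : pi0%:~R < d p /\ d p < pi0%:~R + 1.
    split; rewrite ltNge; apply/negP => h; apply: nsd; rewrite /side b1; [left|right]; exact: h.
  have [[i Hi]|Hno] := pselect (exists i, side pi pi0 (2^-1 *: (V' i + ((1 - eps) *: q + eps *: (p, sp))))).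
    apply: (split_step (i := i) (v := V')) => //.
    exact: convex_rank.
  case: n2.
  (* With no usable index, every [v i] lies on a boundary hyperplane. The barycentre is strictly
     between them, so both occur and the integer points of [F] are 2-partitionable. *)
  have dv i : d (v i) = pi0%:~R \/ d (v i) = pi0%:~R + 1.
    have ns : ~ side pi pi0 (2^-1 *: (V' i + ((1 - eps) *: q + eps *: (p, sp)))).
      by move=> h; apply: Hno; exists i.
    have E : dotR (intvecR R pi) (2^-1 *: (V' i + ((1 - eps) *: q + eps *: (p, sp)))).1
        = 2^-1 * (d (v i) + d p).
      by rewrite -dotRDr -dotRZr -[in RHS](b1 eps).
    have [z Ez] : is_int (d (v i)) by apply: is_int_dotR; exact: (vint i).
    rewrite Ez; have [|->|->] := @int_between z pi0 (d p) dp0 dp1.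
    - by move: ns; rewrite /side E Ez.
    - by left.
    - by right; rewrite intrD.
  have dpE : d p = \sum_(i < n) n%:R^-1 * d (v i) by rewrite /d dotR_sumr.
  have const c : (forall i, d (v i) = c) -> d p = c.
    move=> h; rewrite dpE (eq_bigr (fun=> n%:R^-1 * c)) => [|i _]; last by rewrite h.
    by rewrite -mulr_suml w1 mul1r.
  right; exists [set x | (F `&` @int_pt R m) x /\ d x = pi0%:~R],
    [set x | (F `&` @int_pt R m) x /\ d x = pi0%:~R + 1], pi, pi0.
  split; first by move=> x [].
  split; first by move=> x [].
  split.
    by move=> x /[dup] h /ZP/Zv[i Ei]; have [e|e] := dv i; [left|right]; split; rewrite // Ei.
  split.
    apply/seteqP; split=> x // [[_ e1'] [_ e2]]; exfalso.
    have /eqP := etrans (esym e1') e2.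
    by rewrite -subr_eq0 opprD addNKr oppr_eq0 oner_eq0.
  split.
    apply: contrapT => h; have : d p = pi0%:~R + 1.
      apply: const => i; have [e|//] := dv i; case: h; exists (v i); split=> //.
      exact/ZP.
    by move=> E; move: dp1; rewrite E ltxx.
  split.
    apply: contrapT => h; have : d p = pi0%:~R.
      apply: const => i; have [//|e] := dv i; case: h; exists (v i); split=> //.
      exact/ZP.
    by move=> E; move: dp0; rewrite E ltxx.
  by split=> x [].
have [eps /andP[e0 e1] /HT] := claim T.
rewrite cutrowE /= dotRDr !dotRZr leNgt => /negP; apply.
have : dotR (cutrow L f r) q.2 <= 1.
  rewrite snd_sum dotR_sumr -[X in _ <= X]w1; apply: ler_sum => i _.
  by apply: ler_piMr; [exact: w0|have [] := Hs i].
by move: csp e0 e1; move: (dotR _ sp) (dotR _ q.2) => u1 u2; clear w0; nra.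
Qed.

End Necessity.

(** * A convex potential with kinks at half-integers *)

Section Potential.
Variables (R : realType) (m B : nat).
Let I := ('I_m * 'I_(2 * B))%type.
Let ctr (n : 'I_(2 * B)) : R := n%:R - B%:R + 2^-1.

(* The centres are the half-integers between [-B] and [B]. *)
Definition potential (x : 'rV[R]_m) : R := \sum_(q : I) `|x 0 q.1 - ctr q.2|.

Lemma potential_ge0 x : 0 <= potential x.
Proof. exact: sumr_ge0. Qed.

Lemma potential_le x : potential x <= #|{: I}|%:R * (norm1 x + B%:R + 1).
Proof.
rewrite mulr_natl -sumr_const; apply: ler_sum => -[i n] _ /=.
have h1 := coord_le_norm1 x i; have h2 := ler_normB (x 0 i) (ctr n).
have h3 : `|ctr n| <= B%:R + 1.
  have : (n%:R : R) <= (2 * B)%:R by rewrite ler_nat ltnW.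
  have : 0 <= (n%:R : R) by [].
  by rewrite natrM ler_norml /ctr => a b; apply/andP; split; lra.
lra.
Qed.

(** In coordinate [i] every [p j] is at distance at least 1/2 from the centre [n + 1/2], the
    combination at most [1/2 - theta]. The remaining terms are convex. *)
Lemma potential_drop (J : finType) (w : J -> R) (p : J -> 'rV[R]_m) i (n : int) (theta : R) :
  (forall j, 0 <= w j) -> \sum_j w j = 1 -> (- B%:Z <= n < B%:Z)%R ->
  (forall j, p j 0 i <= n%:~R \/ n%:~R + 1 <= p j 0 i) ->
  n%:~R + theta <= (\sum_j w j *: p j) 0 i <= n%:~R + 1 - theta ->
  potential (\sum_j w j *: p j) + theta <= \sum_j w j * potential (p j).
Proof.
move=> w0 w1 nB Hp Hx.
have nb : (absz (n + B%:Z)%R < 2 * B)%N by lia.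
pose q0 : I := (i, Ordinal nb).
have c0 : ctr q0.2 = n%:~R + 2^-1.
  by rewrite /ctr /= natr_absz ger0_norm ?intrD; [rewrite addrK|lia].
have -> : \sum_j w j * potential (p j) =
    \sum_(q : I) \sum_j w j * `|p j 0 q.1 - ctr q.2|.
  by rewrite exchange_big /=; apply: eq_bigr => j _; rewrite mulr_sumr.
rewrite /potential (bigD1 q0) //= [X in _ <= X](bigD1 q0) //= addrAC; apply: lerD.
  have h : 2^-1 <= \sum_j w j * `|p j 0 i - ctr q0.2|.
    rewrite -[X in X <= _]mul1r -[X in X * _ <= _]w1 mulr_suml; apply: ler_sum => j _.
    rewrite ler_wpM2l // c0; have [h|h] := Hp j.
      by rewrite ler0_norm; lra.
    by rewrite ger0_norm; lra.
  apply: le_trans h; rewrite c0 -lerBrDr ler_norml.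
  by case/andP: Hx => a b; apply/andP; split; lra.
apply: ler_sum => q _.
have E : ctr q.2 = \sum_j w j * ctr q.2 by rewrite -mulr_suml w1 mul1r.
rewrite summxE {1}E -sumrB.
apply: le_trans (ler_norm_sum _ _ _) _; apply: ler_sum => j _.
by rewrite mxE -mulrBr normrM ger0_norm.
Qed.

End Potential.

Lemma floor_bound (R : realType) (x : R) (n : int) (B : nat) :
  n%:~R <= x -> x < n%:~R + 1 -> `|x| < B%:R -> (- B%:Z <= n < B%:Z)%R.
Proof.
move=> n1 n2; rewrite ltr_norml => /andP[b1 b2].
have : (- B%:Z)%:~R < (n + 1)%:~R :> R by rewrite intrD mulrNz; apply: lt_trans b1 n2.
have : n%:~R < B%:Z%:~R :> R by apply: le_lt_trans n1 b2.
by rewrite !ltr_int; clear; lia.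
Qed.

(** * Convergence of tilted cuts over the closures *)

Section CutFunctional.
Variables (R : realType) (m k : nat) (c : 'rV[R]_k).
Let XS := ('rV[R]_m * 'rV[R]_k)%type.

(** The function [h + l], where [c] stands for the row of gauge values. *)
Definition cutaff (l : 'rV[R]_m * R^o) (z : XS) := 1 - dotR c z.2 + aff l z.1.

Lemma cutaffD l l' z : cutaff (l + l') z = cutaff l z + aff l' z.1.
Proof. by rewrite /cutaff affD addrA. Qed.

Lemma cutaff_sum l (I : finType) (w : I -> R) (p : I -> XS) :
  \sum_i w i = 1 -> cutaff l (\sum_i w i *: p i) = \sum_i w i * cutaff l (p i).
Proof.
move=> w1; rewrite /cutaff fst_sum snd_sum aff_sum // dotR_sumr -[1 in LHS]w1.
rewrite -sumrB -big_split; apply: eq_bigr => i _ /=; ring.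
Qed.

Lemma split_valid (Q : set XS) l pi pi0 :
  (forall z, Q z -> side pi pi0 z -> cutaff l z <= 0) ->
  forall z, split_closure Q z -> cutaff l z <= 0.
Proof.
move=> H z /(_ pi pi0); rewrite split_hullE => -[n [w [p [w0 [w1 [Qp ->]]]]]].
rewrite cutaff_sum //; apply: sumr_le0 => i _; apply: mulr_ge0_le0 => //.
by have [? ?] := Qp i; apply: H.
Qed.

(** [Psi] adds [eps] times the potential to the tilted cut. Far out the growth bound gives
    [Psi <= eta], and near integer points the Lipschitz bound does; elsewhere an elementary split
    lowers the bound by [eps * theta] per round. *)
Lemma split_closures_converge (P : set XS) l (A kappa K : R) :
  convex P -> 0 < kappa -> 0 <= K ->
  (forall z, P z -> cutaff l z <= A - kappa * norm1 z.1) ->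
  (forall z y, P z -> int_pt y -> cutaff l z <= K * norm1 (z.1 - y)) ->
  forall eta : R, 0 < eta ->
  exists t, forall z, rank_split_closure t P z -> cutaff l z <= eta.
Proof.
move=> cP k0 K0 PA PK eta eta0.
(* Once a coordinate reaches [B] in absolute value, half of the growth rate already compensates
   [A]. *)
pose B := Num.bound (2 * `|A| / kappa).
have B0 : 0 <= B%:R :> R by [].
have AB : A <= kappa / 2 * B%:R.
  have : 2 * `|A| / kappa < B%:R by apply: archi_boundP; rewrite divr_ge0 ?mulr_ge0 // ltW.
  by rewrite ltr_pdivrMr //; have := ler_norm A; lra.
pose N : R := #|{: 'I_m * 'I_(2 * B)}|%:R.
have N0 : 0 <= N by [].
have m0 : 0 <= m%:R :> R by [].
pose M1 := N * (m%:R * B%:R + B%:R + 1) + 1.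
have M10 : 0 < M1 by rewrite ltr_wpDl // mulr_ge0 // addr_ge0 // addr_ge0 // mulr_ge0.
(* The potential may use up half of the growth rate, and at most [eta / 2] on the box of radius
   [B]. *)
pose eps := Num.min (kappa / (2 * (N + 1))) (eta / (2 * M1)).
have N1 : 0 < 2 * (N + 1) by lra.
have M2 : 0 < 2 * M1 by lra.
have eps0 : 0 < eps by rewrite lt_min !divr_gt0.
have eps1 : eps * N <= kappa / 2.
  have : eps <= kappa / (2 * (N + 1)) by rewrite ge_min lexx.
  by rewrite ler_pdivlMr //; nra.
have eps2 : eps * (N * (m%:R * B%:R + B%:R + 1)) <= eta / 2.
  have : eps <= eta / (2 * M1) by rewrite ge_min lexx orbT.
  by rewrite ler_pdivlMr // /M1; lra.
have eps3 : eps * (N * (B%:R + 1)) <= eta / 2.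
  apply: le_trans eps2; rewrite ler_pM2l // ler_wpM2l // lerD2r lerDr.
  exact: mulr_ge0.
(* Within [theta] of an integer in every coordinate, the tilted cut is at most [eta / 2]. *)
pose theta := Num.min 2^-1 (eta / (2 * (K * m%:R + 1))).
have Km : 0 < 2 * (K * m%:R + 1) by rewrite mulr_gt0 // ltr_wpDl // mulr_ge0.
have th0 : 0 < theta by rewrite lt_min divr_gt0 // invr_gt0 ltr0n.
have th1 : K * (m%:R * theta) <= eta / 2.
  have : theta <= eta / (2 * (K * m%:R + 1)) by rewrite ge_min lexx orbT.
  by rewrite ler_pdivlMr // mulrA; lra.
pose Psi z := cutaff l z + eps * potential B z.1.
pose M0 := A + eps * (N * (B%:R + 1)).
have PsiE z : P z -> Psi z <= A - kappa / 2 * norm1 z.1 + eps * (N * (B%:R + 1)).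
  move=> Pz; rewrite /Psi; have h := PA z Pz.
  have : eps * potential B z.1 <= eps * (N * (norm1 z.1 + B%:R + 1)).
    by rewrite ler_pM2l // potential_le.
  by have := norm1_ge0 z.1; nra.
have step t z : rank_split_closure t P z -> Psi z <= Num.max eta (M0 - t%:R * (eps * theta)).
  elim: t z => [|t IH] z Hz.
    rewrite le_max; apply/orP; right; rewrite mul0r subr0.
    by apply: le_trans (PsiE z Hz) _; have := norm1_ge0 z.1; rewrite /M0; nra.
  have Pz : P z by apply: (rank_le (s := 0%N) cP _ Hz).
  have [[i Hi]|Hin] := pselect (exists i, B%:R <= `|z.1 0 i|).
    rewrite le_max; apply/orP; left.
    apply: le_trans (PsiE z Pz) _.
    have : kappa / 2 * B%:R <= kappa / 2 * norm1 z.1.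
      by rewrite ler_pM2l ?divr_gt0 //; apply: le_trans Hi (coord_le_norm1 _ _).
    by lra.
  have {}Hin i : `|z.1 0 i| < B%:R.
    by rewrite ltNge; apply/negP => h; apply: Hin; exists i.
  have [Hnear|Hfar] := pselect (forall i, exists n : int, `|z.1 0 i - n%:~R| <= theta).
    rewrite le_max; apply/orP; left.
    have [y Hy] := choice Hnear.
    have h1 : cutaff l z <= eta / 2.
      apply: le_trans th1.
      apply: le_trans (PK z (\row_i (y i)%:~R) Pz _) _.
        by move=> i; exists (y i); rewrite mxE.
      rewrite ler_wpM2l //; apply: norm1_le => i; rewrite !mxE; exact: Hy.
    have h2 : eps * potential B z.1 <= eta / 2.
      apply: le_trans eps2; rewrite ler_pM2l //.
      apply: le_trans (potential_le _ _) _; rewrite ler_wpM2l // lerD2r lerD2r.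
      by apply: norm1_le => i; apply: ltW.
    by rewrite /Psi; lra.
  have [i Hi] : exists i, ~ exists n : int, `|z.1 0 i - n%:~R| <= theta.
    apply: contrapT => h; apply: Hfar => i; apply: contrapT => h'.
    by apply: h; exists i.
  pose n := Num.floor (z.1 0 i).
  have /andP[n1 n2] : n%:~R <= z.1 0 i < (n + 1)%:~R.
    by rewrite /n real_floor_le ?real_floorD1_gt ?num_real.
  have n3 : n%:~R + theta <= z.1 0 i.
    rewrite leNgt; apply/negP => h; apply: Hi; exists n.
    by rewrite ger0_norm; lra.
  rewrite intrD in n2.
  have n4 : z.1 0 i <= n%:~R + 1 - theta.
    rewrite leNgt; apply/negP => h; apply: Hi; exists (n + 1).
    by rewrite intrD ler0_norm; lra.
  have nB : (- B%:Z <= n < B%:Z)%R.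
    exact: floor_bound n1 n2 (Hin i).
  have := Hz (delta_mx 0 i) n; rewrite split_hullE => -[q [w [p [w0 [w1 [Qp Ez]]]]]].
  have hp j : (p j).1 0 i <= n%:~R \/ n%:~R + 1 <= (p j).1 0 i.
    have [_] := Qp j; rewrite /side.
    suff -> : intvecR R (delta_mx 0 i) = delta_mx 0 i by rewrite dotR_delta.
    by apply/rowP => j'; rewrite !mxE; case: (_ && _).
  have := @potential_drop _ _ B _ w (fun j => (p j).1) i n theta w0 w1 nB hp.
  rewrite -(fst_sum w p) -Ez n3 n4 => /(_ isT) hd.
  have : Psi z <= \sum_j w j * Psi (p j) - eps * theta.
    have -> : \sum_j w j * Psi (p j) =
        \sum_j w j * cutaff l (p j) + eps * \sum_j w j * potential B (p j).1.
      rewrite mulr_sumr -big_split /=; apply: eq_bigr => j _; rewrite /Psi; ring.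
    rewrite /Psi Ez -cutaff_sum // -Ez.
    have : eps * (potential B z.1 + theta) <= eps * \sum_j w j * potential B (p j).1.
      by rewrite ler_pM2l.
    by rewrite mulrDr; lra.
  move=> h; apply: (le_trans h).
  have : \sum_j w j * Psi (p j) <= Num.max eta (M0 - t%:R * (eps * theta)).
    rewrite -[X in _ <= X]mul1r -[X in _ <= X * _]w1 mulr_suml; apply: ler_sum => j _.
    by rewrite ler_wpM2l // IH //; have [] := Qp j.
  have et0 : 0 < eps * theta by rewrite mulr_gt0.
  move: (\sum_j w j * Psi (p j)) => S.
  rewrite !le_max -natr1 mulrDl mul1r => /orP[hS|hS]; apply/orP; [left|right]; lra.
have et0 : 0 < eps * theta by rewrite mulr_gt0.
(* Enough rounds to bring the decreasing bound below [eta]. *)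
exists (Num.bound (`|M0| / (eps * theta))) => z Hz.
have h1 := step _ z Hz.
have h2 : M0 - (Num.bound (`|M0| / (eps * theta)))%:R * (eps * theta) <= eta.
  have : `|M0| / (eps * theta) < (Num.bound (`|M0| / (eps * theta)))%:R.
    by apply: archi_boundP; rewrite divr_ge0 // ltW.
  by rewrite ltr_pdivrMr //; have := ler_norm M0; lra.
move: h1; rewrite (max_idPl h2) /Psi.
by have := mulr_ge0 (ltW eps0) (potential_ge0 B z.1); lra.
Qed.

End CutFunctional.

(** * Sufficiency: tilted cuts and induction on their tight points *)

Lemma rat_common_denominator (R : realType) (m : nat) (a : 'rV[R]_m) : rat_pt a ->
  exists (D : int) (pi : 'rV[int]_m), 0 < D /\ intvecR R pi = D%:~R *: a.
Proof.
move=> /choice[q Hq]; pose D := \prod_i denq (q i).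
have HD i : exists n : int, D%:~R * q i = n%:~R :> rat.
  exists (numq (q i) * \prod_(j | j != i) denq (q j)).
  rewrite /D (bigD1 i) //= !intrM mulrAC; congr (_ * _).
  by rewrite mulrC -numqE.
have [n Hn] := choice HD.
exists D, (\row_i n i); split; first by apply: prodr_gt0 => i _; apply: denq_gt0.
apply/rowP => i; rewrite !mxE Hq -(ratr_int _ (n i)) -Hn rmorphM /=.
by rewrite ratr_int.
Qed.

Lemma uniform_threshold (R : realType) (T : eqType) (s : seq T) (C : T -> R -> Prop) :
  (forall x, x \in s -> exists2 e : R, 0 < e & forall N, 0 < N <= e -> C x N) ->
  exists2 e : R, 0 < e & forall x N, x \in s -> 0 < N <= e -> C x N.
Proof.
elim: s => [_|x s IH Hs]; first by exists 1.
have [y ys|e e0 He] := IH; first by apply: Hs; rewrite inE ys orbT.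
have [e' e'0 He'] := Hs x (mem_head _ _).
exists (Num.min e e'); first by rewrite lt_min e0.
move=> y N; rewrite inE le_min => /orP[/eqP->|ys] /and3P[N0 N1 N2].
  by apply: He'; rewrite N0.
by apply: He; rewrite ?N0.
Qed.

Section Sufficiency.
Variables (R : realType) (m k : nat) (L : set 'rV[R]_m) (c : 'rV[R]_k).
Variables (P : set ('rV[R]_m * 'rV[R]_k)) (Phi : seq ('rV[R]_m * R^o)).
Hypothesis cP : convex P.
Hypothesis rPhi : forall l, l \in Phi -> rat_aff l.
Hypothesis LPhi : forall x, L x <-> forall l, l \in Phi -> 0 <= aff l x.
Hypothesis PPhi : forall z l, P z -> l \in Phi -> 1 - dotR c z.2 <= aff l z.1.
Hypothesis Lfree : lattice_free L.
Implicit Types (l : 'rV[R]_m * R^o).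

Lemma noninterior_support x : ~ interior_pt L x -> exists2 l, l \in Phi & aff l x <= 0.
Proof.
move=> nx; apply: contrapT => h; apply: nx.
have [|e [e0 He]] := @aff_gt0_near _ _ Phi x.
  by move=> l lP; rewrite ltNge; apply/negP => lx; apply: h; exists l.
by exists e; split=> // y /He Hy; apply/LPhi.
Qed.

Lemma int_support z : int_pt z -> exists2 l, l \in Phi & aff l z <= 0.
Proof. by move=> /Lfree; apply: noninterior_support. Qed.

(* The cut tilted by [l] is valid at the integer points, and is tight only at the
   integer points of [L] where [l] vanishes. *)
Record admissible l : Prop := Admissible {
  admissible_rat : rat_aff l;
  admissible_growth : exists A kappa : R, 0 < kappa /\
    forall x, exists2 phi, phi \in Phi & aff phi x + aff l x <= A - kappa * norm1 x;
  admissible_int : forall z, int_pt z -> ~ (L z /\ aff l z = 0) ->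
    exists2 phi, phi \in Phi & aff phi z + aff l z < 0 }.

Lemma admissible_le0 l z : admissible l -> int_pt z ->
  exists2 phi, phi \in Phi & aff phi z + aff l z <= 0.
Proof.
move=> al iz; have [[Lz lz]|n] := pselect (L z /\ aff l z = 0).
  by have [phi ? ?] := int_support iz; exists phi; rewrite // lz addr0.
by have [phi ? /ltW ?] := admissible_int al iz n; exists phi.
Qed.

Lemma admissible_L_le0 l z : admissible l -> int_pt z -> L z -> aff l z <= 0.
Proof.
move=> al iz Lz; have [phi pP h] := admissible_le0 al iz.
by have := proj1 (LPhi z) Lz phi pP; lra.
Qed.

(** The Lipschitz bound starts from a function [phi + l] that is at most 0 at the given integer
    point; [K] is the largest gradient norm in the family. *)
Lemma admissible_converge l : admissible l -> forall eta : R, 0 < eta ->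
  exists t, forall z, rank_split_closure t P z -> cutaff c l z <= eta.
Proof.
move=> al eta eta0.
have [A [kappa [k0 Hg]]] := admissible_growth al.
have [K K0 HK] : exists2 K : R, 0 <= K & forall phi, phi \in Phi -> norm1 (phi + l).1 <= K.
  pose g phi := norm1 (phi + l).1.
  exists (\big[Num.max/0]_(phi <- Phi) g phi); first exact: bigmax_ge_id.
  by move=> phi pP; rewrite -/(g phi); apply: le_bigmax_seq.
have PP z phi : P z -> phi \in Phi -> cutaff c l z <= aff phi z.1 + aff l z.1.
  by move=> Pz pP; rewrite /cutaff lerD2r; apply: PPhi.
apply: (split_closures_converge cP k0 K0) eta0.
  by move=> z Pz; have [phi pP] := Hg z.1; apply: le_trans; apply: PP.
move=> z y Pz iy; have [phi pP h] := admissible_le0 al iy.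
apply: le_trans (PP z phi Pz pP) _; rewrite -affD.
apply: le_trans (aff_lipschitz _ _ y) _; rewrite affD.
have : norm1 (phi + l).1 * norm1 (z.1 - y) <= K * norm1 (z.1 - y).
  by rewrite ler_wpM2r ?norm1_ge0 // HK.
by move=> h'; apply: le_trans (lerD h h') _; rewrite add0r.
Qed.

(** For small [N], half of the growth rate survives and keeps distant integer points strictly valid;
    the finitely many others share a threshold. A tight point stays tight only where [l']
    vanishes. *)
Lemma tilt l l' : admissible l -> rat_aff l' ->
  (forall z, int_pt z -> L z -> aff l z = 0 -> aff l' z <= 0) ->
  exists N : R, [/\ 0 < N, admissible (l + N *: l') &
    forall z, int_pt z -> L z -> aff (l + N *: l') z = 0 -> aff l z = 0 /\ aff l' z = 0].
Proof.
move=> al rl' Hl'.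
have [A [kappa [k0 Hg]]] := admissible_growth al.
pose K := norm1 l'.1 + `|l'.2 : R| + 1.
have K0 : 0 < K by rewrite ltr_wpDl // addr_ge0 ?norm1_ge0.
have HK x : aff l' x <= K * (1 + norm1 x).
  apply: le_trans (aff_norm1 l' x) _; rewrite ler_wpM2r ?addr_ge0 ?norm1_ge0 //.
  by rewrite lerDl.
pose e1 := kappa / (2 * K).
have e10 : 0 < e1 by rewrite divr_gt0 // mulr_gt0.
have grow N x : 0 < N <= e1 -> exists2 phi, phi \in Phi &
    aff phi x + aff (l + N *: l') x <= A + kappa / 2 - kappa / 2 * norm1 x.
  move=> /andP[N0 N1]; have [phi pP h] := Hg x; exists phi => //.
  rewrite affD affZ.
  have h1 : N * aff l' x <= N * (K * (1 + norm1 x)) by rewrite ler_pM2l.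
  have h2 : N * K <= kappa / 2.
    by move: N1; rewrite /e1 ler_pdivlMr ?mulr_gt0 //; lra.
  by have := norm1_ge0 x; nra.
pose B := Num.bound (2 * `|A + kappa / 2| / kappa).
have AB (x : 'rV[R]_m) : B%:R <= norm1 x -> A + kappa / 2 - kappa / 2 * norm1 x < 0.
  have : 2 * `|A + kappa / 2| / kappa < B%:R.
    by apply: archi_boundP; rewrite divr_ge0 ?mulr_ge0 // ltW.
  rewrite ltr_pdivrMr //; have := ler_norm (A + kappa / 2) => h1 h2 h3.
  have : kappa * B%:R <= kappa * norm1 x by rewrite ler_pM2l.
  by lra.
have [Z HZ] := @int_box R m B.
pose C z (N : R) := int_pt z -> ~ [/\ L z, aff l z = 0 & aff l' z = 0] ->
  exists2 phi, phi \in Phi & aff phi z + aff (l + N *: l') z < 0.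
have [z _|e2 e20 He2] := @uniform_threshold R _ Z C.
  have [iz|niz] := pselect (int_pt z); last by exists 1 => [|N _ /niz //]; apply: ltr01.
  have [[Lz lz]|nS] := pselect (L z /\ aff l z = 0).
    exists 1 => // N /andP[N0 _] _ n3.
    have [phi pP h] := int_support iz; exists phi => //.
    have l'z : aff l' z < 0.
      rewrite lt_neqAle Hl' // andbT; apply/eqP => l'z; exact: n3 (And3 Lz lz l'z).
    rewrite affD affZ lz add0r; have : N * aff l' z < 0 by rewrite pmulr_rlt0.
    by lra.
  have [phi pP h] := admissible_int al iz nS.
  pose d := - (aff phi z + aff l z).
  have d0 : 0 < d by rewrite oppr_gt0.
  exists (d / (2 * (`|aff l' z| + 1))).
    by rewrite divr_gt0 // mulr_gt0 // ltr_wpDl.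
  move=> N /andP[N0]; rewrite ler_pdivlMr ?mulr_gt0 ?ltr_wpDl // => N1 _ _.
  exists phi => //; rewrite affD affZ.
  have : N * aff l' z <= N * `|aff l' z| by rewrite ler_pM2l // ler_norm.
  have := mulr_ge0 (ltW N0) (normr_ge0 (aff l' z)).
  by move: N1 d0; rewrite /d; move: (aff l' z) `|_| => u v; lra.
(* [N] is the reciprocal of a natural number, so the tilted function stays rational. *)
pose n := Num.bound (Num.min e1 e2)^-1.
have e0 : 0 < Num.min e1 e2 by rewrite lt_min e10.
have n0 : (Num.min e1 e2)^-1 < n%:R by apply: archi_boundP; rewrite invr_ge0 ltW.
have nn : 0 < (n%:R : R) by apply: lt_trans n0; rewrite invr_gt0.
pose N : R := n%:R^-1.
have N0 : 0 < N by rewrite invr_gt0.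
have : N <= Num.min e1 e2.
  by rewrite -[X in _ <= X]invrK lef_pV2 ?posrE ?invr_gt0 // ltW.
rewrite le_min => /andP[N1 N2].
have key z : int_pt z -> ~ [/\ L z, aff l z = 0 & aff l' z = 0] ->
    exists2 phi, phi \in Phi & aff phi z + aff (l + N *: l') z < 0.
  move=> iz n3; have [h|h] := leP B%:R (norm1 z).
    have [|phi pP h'] := grow N z; first by rewrite N0.
    by exists phi => //; apply: le_lt_trans h' (AB z h).
  apply: He2 => //; last by rewrite N0.
  by apply: HZ => // i; apply: le_trans (coord_le_norm1 _ _) (ltW h).
exists N; split=> //.
  split.
  - apply: rat_affD; first exact: admissible_rat al.
    by apply: rat_affZ => //; apply/is_ratV/is_rat_nat.
  - exists (A + kappa / 2), (kappa / 2); split; first by rewrite divr_gt0.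
    by move=> x; apply: grow; rewrite N0.
  - move=> z iz nS; apply: key => // -[Lz lz l'z]; apply: nS; split=> //.
    by rewrite affD affZ lz l'z mulr0 addr0.
move=> z iz Lz E; apply: contrapT => n2.
have [|phi pP] := key z iz; first by move=> [_ ? ?]; apply: n2.
by rewrite E addr0 ltNge (proj1 (LPhi z) Lz).
Qed.

(** One split parallel to [l' = phi0 + l] separates [l' <= 0], where the support bound suffices,
    from [l' >= 1 / D], where the term [N * l'] outweighs the error [N / D] of the tilted cut. *)
Lemma valid_of_support l phi0 z0 : admissible l -> phi0 \in Phi ->
  int_pt z0 -> L z0 -> aff l z0 = 0 ->
  (forall z, int_pt z -> L z -> aff l z = 0 -> aff phi0 z = 0) ->
  exists t, forall z, rank_split_closure t P z -> cutaff c l z <= 0.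
Proof.
move=> al pP iz0 Lz0 lz0 H0.
pose l' := phi0 + l.
have rl' : rat_aff l' by apply: rat_affD; [apply: rPhi|apply: admissible_rat].
have [|N [N0 aN _]] := tilt al rl'.
  by move=> z iz Lz lz; rewrite affD lz H0 // addr0.
have [|D [pi [D0 Epi]]] := @rat_common_denominator R m (- l'.1).
  by move=> i; rewrite mxE; apply: is_ratN; case: rl'.
(* Since [l'] vanishes at the integer point [z0], its zero set is an integer level of [pi]. *)
have [d Ed] : is_int (dotR (intvecR R pi) z0) by apply: is_int_dotR.
have D0' : 0 < (D%:~R : R) by rewrite ltr0z.
have El' x : D%:~R * aff l' x = d%:~R - dotR (intvecR R pi) x.
  rewrite -Ed Epi !dotRZl !dotRNl.
  have : aff l' z0 = 0 by rewrite affD lz0 H0 // addr0.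
  by rewrite /aff => h; rewrite -mulrBr; congr (_ * _); lra.
have [|t Ht] := admissible_converge aN (eta := N / D%:~R); first by rewrite divr_gt0.
(* [pi x <= d - 1] means [D * l' >= 1], and [pi x >= d] means [l' <= 0]. *)
exists t.+1; apply: (split_valid (pi := pi) (pi0 := d - 1)) => z Qz.
have h := Ht z Qz; rewrite cutaffD affZ in h.
have Pz : P z by apply: (rank_le (s := 0%N) cP _ Qz).
rewrite /side intrD mulrN1z subrK => -[hs|hs].
  have : 1 <= D%:~R * aff l' z.1 by rewrite El'; lra.
  rewrite mulrC -ler_pdivrMr // mul1r => h1.
  have : N * D%:~R^-1 <= N * aff l' z.1 by rewrite ler_pM2l.
  by lra.
have : D%:~R * aff l' z.1 <= 0 by rewrite El'; lra.
rewrite pmulr_rle0 // affD => h1.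
by apply: le_trans h1; rewrite /cutaff lerD2r; apply: PPhi.
Qed.

(** [Z] contains all tight points, and its length is the induction measure. *)
Lemma two_hyperplane_valid n (Z : seq 'rV[R]_m) l :
  two_hyperplane_property L -> convex L ->
  (size Z < n)%N -> admissible l ->
  (forall z, int_pt z -> L z -> aff l z = 0 -> z \in Z) ->
  exists t, forall z, rank_split_closure t P z -> cutaff c l z <= 0.
Proof.
move=> H2 cL; elim: n Z l => // n IH Z l; rewrite ltnS => Zn al HZ.
have [[z0 [iz0 Lz0 lz0]]|nS] := pselect (exists z0, [/\ int_pt z0, L z0 & aff l z0 = 0]); last first.
  (* Without tight points the cut can be tilted by a positive constant, and convergence to within
     that constant suffices. *)
  have [||N [N0 aN _]] := @tilt l (0, 1) al.
  - by split=> [i|]; rewrite ?mxE; [apply: (is_rat_nat _ 0)|apply: (is_rat_nat _ 1)].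
  - by move=> z iz Lz lz; case: nS; exists z.
  have [t Ht] := admissible_converge aN N0; exists t => z /Ht.
  by rewrite cutaffD affZ /aff /= dotR0l add0r mulr1 gerDr.
(* The tight points are the integer points of this face. *)
pose F := [set x | int_hull L x /\ dotR l.1 x = - l.2].
have hullL x : int_hull L x -> L x.
  by move=> H; apply: cL; apply: conv_mono H => y [].
have hull_le x : int_hull L x -> dotR l.1 x <= - l.2.
  have h y : (L y /\ int_pt y) -> 0 <= aff ((-1) *: l) y.
    by move=> [Ly iy]; rewrite affZ mulN1r oppr_ge0; apply: admissible_L_le0.
  by move=> /(aff_conv_ge0 h); rewrite affZ /aff; lra.
have Fface : face (int_hull L) F by exists l.1, (- l.2).
have FP z : int_pt z -> F z <-> (L z /\ aff l z = 0).
  move=> iz; split=> [[/hullL Lz E]|[Lz E]]; split=> //.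
  - by rewrite /aff E addrC subrr.
  - exact: sub_conv.
  - by apply/eqP; rewrite -subr_eq0 opprK; apply/eqP.
have [[G [facG FG]]|nG] := pselect (exists G, facet L G /\ F `<=` G).
  pose Z' := [seq z <- Z | `[< [/\ int_pt z, L z & aff l z = 0] >]].
  have Z'P z : z \in Z' <-> [/\ int_pt z, L z & aff l z = 0].
    rewrite mem_filter; split=> [/andP[/asboolP]//|H]; apply/andP; split; first exact/asboolP.
    by case: H => *; apply: HZ.
  pose q := size Z'.
  have q0 : (q%:R : R) != 0.
    rewrite pnatr_eq0 size_eq0; apply/eqP => Z'0.
    by have : z0 \in Z' by [apply/Z'P]; rewrite Z'0.
  pose v (i : 'I_q) := nth 0 Z' i.
  have vP i : [/\ int_pt (v i), L (v i) & aff l (v i) = 0] by apply/Z'P/mem_nth.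
  have w0 (i : 'I_q) : 0 <= (q%:R^-1 : R) by rewrite invr_ge0.
  have w1 : \sum_(i < q) (q%:R^-1 : R) = 1.
    by rewrite sumr_const card_ord -[LHS]mulr_natr mulVf.
  (* The barycentre of the tight points lies in the facet, so some supporting function vanishes
     there, hence at all tight points. *)
  pose p := \sum_(i < q) q%:R^-1 *: v i.
  have Fp : F p.
    apply: convex_sum => //; first exact: convex_face (@convex_conv _ _ _) Fface.
    by move=> i; have [? ? ?] := vP i; apply/FP.
  have np : ~ interior_pt L p.
    move=> pint; have := FG _ Fp.
    have [[a [b [va EG]]] [d [[L2 _] [_ G2]]]] := facG; rewrite EG => -[_ ap].
    have a0 : a != 0.
      apply/eqP => a0; apply: G2; suff -> : G = L by [].
      rewrite EG; apply/seteqP; split=> x; first by case.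
      by move=> Lx; split=> //; rewrite -ap a0 !dotR0l.
    have : 0 < aff ((- a, b) : 'rV[R]_m * R^o) p.
      apply: interior_aff_gt0 pint => [y /va|]; rewrite /aff /= ?oppr_eq0 //.
      by rewrite dotRNl addrC subr_ge0.
    by rewrite /aff /= dotRNl ap addrC subrr ltxx.
  have [phi pP hp] := noninterior_support np.
  apply: (valid_of_support al pP iz0 Lz0 lz0) => z iz Lz lz.
  have hphi x : L x -> 0 <= aff phi x by move=> /LPhi; apply.
  have /(nthP 0)[i iq <-] : z \in Z' by apply/Z'P.
  have := @aff_eq0_summand _ _ phi _ _ v w0 w1 _ _ (Ordinal iq).
  case=> //.
  - by move=> j; apply: hphi; have [] := vP j.
  - by apply/eqP; rewrite eq_le hp hphi //; apply: hullL; have [] := Fp.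
  - by move/eqP; rewrite invr_eq0 (negPf q0).
have [Hone|[S1 [S2 [pi [pi0 [S1F [S2F [FS [_ [[y1 Sy1] [[y2 Sy2] [E1 E2]]]]]]]]]]]] := H2 F Fface nG.
  (* There is a single tight point, and lattice-freeness gives a supporting function vanishing at
     it. *)
  have [phi pP hp] := int_support iz0.
  have hp0 : aff phi z0 = 0 by apply/eqP; rewrite eq_le hp (proj1 (LPhi z0)).
  apply: (valid_of_support al pP iz0 Lz0 lz0) => z iz Lz lz.
  by rewrite (Hone z z0) //; split=> //; apply/FP.
pose d x := dotR (intvecR R pi) x.
have rd : rat_pt (intvecR R pi) by move=> i; rewrite mxE; apply: is_rat_int.
have Sd z : int_pt z -> L z -> aff l z = 0 -> d z = pi0%:~R \/ d z = pi0%:~R + 1.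
  move=> iz Lz lz; have /FS[/E1 ?|/E2 ?] : (F `&` @int_pt R m) z by split=> //; apply/FP.
    by left.
  by right.
have inZ y : (F `&` @int_pt R m) y -> y \in Z.
  by move=> [Fy iy]; have [? ?] := proj1 (FP y iy) Fy; apply: HZ.
have d12 : (pi0%:~R + 1 : R) != pi0%:~R.
  by rewrite -subr_eq0 addrAC subrr add0r oner_eq0.
(* The tilt removes the tight points off the hyperplane [d = e], among them [y], so the induction
   hypothesis applies. *)
have half l1 e y : rat_aff l1 ->
    (forall z, int_pt z -> L z -> aff l z = 0 -> aff l1 z <= 0) ->
    (forall z, aff l1 z = 0 -> d z = e) -> y \in Z -> d y != e ->
    exists N t, 0 < N /\ forall z, rank_split_closure t P z -> cutaff c l z + N * aff l1 z.1 <= 0.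
  move=> rl1 l1S l1e yZ dy.
  have [N [N0 aN SN]] := tilt al rl1 l1S.
  have [||t Ht] := IH [seq z <- Z | d z == e] _ _ aN.
  - rewrite size_filter; apply: leq_trans Zn.
    by rewrite -(count_predC (fun z => d z == e) Z) -addn1 leq_add2l -has_count; apply/hasP; exists y.
  - move=> z iz Lz /(SN z iz Lz)[lz l1z]; rewrite mem_filter HZ // andbT.
    exact/eqP/l1e.
  by exists N, t; split=> // z /Ht; rewrite cutaffD affZ.
(* [l1] and [l2] are nonpositive at the tight points, and each is nonnegative on one side of the
   split, where its tilted cut implies the cut. *)
pose l1 : 'rV[R]_m * R^o := (- intvecR R pi, pi0%:~R).
pose l2 : 'rV[R]_m * R^o := (intvecR R pi, - (pi0%:~R + 1)).
have l1E x : aff l1 x = pi0%:~R - d x by rewrite /aff /= dotRNl addrC.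
have l2E x : aff l2 x = d x - (pi0%:~R + 1) by [].
have [|||||N1 [t1 [N10 H1]]] := half l1 pi0%:~R y2.
- by split; [move=> i; rewrite mxE; apply: is_ratN|apply: is_rat_int].
- by move=> z iz Lz lz; rewrite l1E; have [->|->] := Sd z iz Lz lz; lra.
- by move=> z; rewrite l1E => /subr0_eq.
- by apply: inZ; apply: S2F.
- by rewrite /d E2.
have [|||||N2 [t2 [N20 H2']]] := half l2 (pi0%:~R + 1) y1.
- split=> //; apply: is_ratN; apply: is_ratD; [exact: is_rat_int|exact: (is_rat_nat _ 1)].
- by move=> z iz Lz lz; rewrite l2E; have [->|->] := Sd z iz Lz lz; lra.
- by move=> z; rewrite l2E => /subr0_eq.
- by apply: inZ; apply: S1F.
- by rewrite /d E1 // eq_sym.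
exists (maxn t1 t2).+1; apply: (split_valid (pi := pi) (pi0 := pi0)) => z Qz.
have h1 := H1 z (rank_le cP (leq_maxl t1 t2) Qz).
have h2 := H2' z (rank_le cP (leq_maxr t1 t2) Qz).
move: h1 h2; rewrite l1E l2E /side -/(d z.1) => h1 h2 [hs|hs].
  have : 0 <= N1 * (pi0%:~R - d z.1) by apply: mulr_ge0; rewrite ?subr_ge0 // ltW.
  by move=> h3; apply: le_trans h1; rewrite lerDl.
have : 0 <= N2 * (d z.1 - (pi0%:~R + 1)) by apply: mulr_ge0; rewrite ?subr_ge0 // ltW.
by move=> h3; apply: le_trans h2; rewrite lerDl.
Qed.

End Sufficiency.

(** * The equivalence, with sufficiency started from the untilted cut *)

Theorem theorem1 (R : realType) (m k : nat) (f : 'rV[R]_m)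
    (r : 'I_k -> 'rV[R]_m) (L : set 'rV[R]_m) :
  (0 < m)%N -> (0 < k)%N ->
  rat_pt f -> ~ int_pt f ->
  (forall j, rat_pt (r j) /\ r j != 0) ->
  mixed_set f r !=set0 ->
  rational_polytope L -> lattice_free L -> interior_pt L f ->
  rays_into_corners L f r ->
  (Lcut_finite_split_rank L f r <-> two_hyperplane_property L).
Proof.
move=> m0 _ rf _ _ _ [V [rV LV]] Lfree fint Hr; split.
  exact: finite_rank_two_hyperplane m0 rV LV rf fint Hr.
move=> H2.
have fint' : interior_pt (conv (fun y => y \in V)) f by rewrite -LV.
have [Phi [rPhi fPhi LPhi [A [kappa [k0 Hg]]]]] := support_family m0 rV rf fint'.
rewrite -LV in LPhi.
have cL : convex L by rewrite LV; apply: convex_conv.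
have [B HB] := polytope_bounded V; have [Z HZ] := @int_box R m B.
have aff0 (x : 'rV[R]_m) : aff (0 : 'rV[R]_m * R^o) x = 0 by rewrite /aff dotR0l addr0.
have PPhi z l : relaxP f r z -> l \in Phi -> 1 - dotR (cutrow L f r) z.2 <= aff l z.1.
  by move=> Pz lP; apply: (cut_le_aff fint) Pz => [x /LPhi|]; [apply|apply: fPhi].
(* For [l = 0] the points allowed to be tight are all integer points of [L]; at any other integer
   point some supporting function is negative. *)
have a0 : admissible L Phi 0.
  split.
  - by split=> [i|]; rewrite ?mxE; apply: (is_rat_nat _ 0).
  - by exists A, kappa; split=> // x; have [l lP h] := Hg x; exists l; rewrite // aff0 addr0.
  - move=> z iz nz; apply: contrapT => h; apply: nz; split; last exact: aff0.
    apply/LPhi => l lP; rewrite leNgt; apply/negP => lz; apply: h.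
    by exists l; rewrite // aff0 addr0.
have [|t Ht] := two_hyperplane_valid (@convex_relaxP _ _ _ f r) rPhi LPhi PPhi Lfree H2 cL
    (ltnSn (size Z)) a0.
  by move=> z iz Lz _; apply: HZ => //; apply: HB; rewrite -LV.
exists t => z /Ht; rewrite cutrowE /cutaff aff0 addr0; lra.
Qed.
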